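(* Let $A:\mathbb{R}^n\to\mathbb{R}^n$ be a linear operator that is generalized strictly totally positive (GSTP) with respect to a totally positive structure $\{K_1,\ldots,K_n\}$. Then all eigenvalues of $A$ are positive and simple: $$\rho(A)=\lambda_1>\lambda_2>\cdots>\lambda_n>0.$$ Let $x_j$ be an eigenvector corresponding to $\lambda_j$ ($j=1,\ldots,n$). Then $x_1\in\operatorname{int}(K_1)$, and for $j\ge 2$, $x_j\in\operatorname{int}(T(K_1,\ldots,K_j))\setminus T(K_1,\ldots,K_{j-1})$. Moreover, for all $1\le q\le p\le n$ and real numbers $c_q,\ldots,c_p$: $$\sum_{i=q}^p c_ix_i\in\operatorname{int}(T(K_1,\ldots,K_p))\setminus T(K_1,\ldots,K_{q-1})\quad\text{whenever } c_p\neq 0,$$ and $$\sum_{i=q}^p c_ix_i\in\overline{T(K_1,\ldots,K_p)\setminus T(K_1,\ldots,K_{q-1})}\quad\text{always},$$ with the convention that $T(K_1,\ldots,K_0)=\emptyset$.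
   Context: A proper cone in a finite-dimensional real space is a closed convex cone $K$ (i.e. $x+y,\alpha x\in K$ for $x,y\in K$, $\alpha\ge0$) that is pointed ($K\cap(-K)=\{0\}$) and solid ($\operatorname{int}K\neq\emptyset$). For $1\le j\le n$, $\wedge^j\mathbb{R}^n$ is the $j$th exterior power of $\mathbb{R}^n$ (dimension $\binom{n}{j}$; $\wedge^1\mathbb{R}^n=\mathbb{R}^n$, $\wedge^n\mathbb{R}^n\cong\mathbb{R}$), and for a linear operator $A$ on $\mathbb{R}^n$, $\wedge^jA$ is the linear operator on $\wedge^j\mathbb{R}^n$ with $(\wedge^jA)(x_1\wedge\cdots\wedge x_j)=Ax_1\wedge\cdots\wedge Ax_j$ (its matrix in the basis $e_{i_1}\wedge\cdots\wedge e_{i_j}$, $i_1<\cdots<i_j$, is the $j$th compound matrix of $A$). A linear operator $B$ on a space with proper cone $K$ is $K$-positive if $B(K\setminus\{0\})\subseteq\operatorname{int}(K)$. A totally positive structure on $\mathbb{R}^n$ is a family $\{K_1,\ldots,K_n\}$ with $K_j\subset\wedge^j\mathbb{R}^n$ a proper cone. $A$ is GSTP with respect to it if $\wedge^jA$ is $K_j$-positive for every $j=1,\ldots,n$ (with $\wedge^1A=A$). The sets $T(K_1,\ldots,K_j)\subseteq\mathbb{R}^n$ are defined recursively: $T(K_1)=K_1\cup(-K_1)$, and for $j\ge2$, $T(K_1,\ldots,K_j)$ is the closure of the set of all $x_1\in\mathbb{R}^n$ for which there exist $x_2\in T(K_1)$, $x_3\in T(K_1,K_2)$, $\ldots$, $x_j\in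 T(K_1,\ldots,K_{j-1})$ with $x_1\wedge x_2\wedge\cdots\wedge x_j\in\operatorname{int}(K_j)\cup\operatorname{int}(-K_j)$.
   Formalization: Since −x_1 is also an eigenvector for λ_1, the claim x_1 ∈ int(K_1) is proved up to sign: x_1 ∈ int(K_1) or x_1 ∈ int(−K_1). The equality ρ(A)=λ_1 is left implicit in the factorization of the characteristic polynomial with λ_1>…>λ_n>0. *)

(* Defs.v *)
From HB Require Import structures.
From mathcomp Require Import all_boot all_order all_algebra.
From mathcomp Require Import all_classical all_reals topology normedtype.
Set Implicit Arguments. Unset Strict Implicit. Unset Printing Implicit Defensive.
Import Order.TTheory GRing.Theory Num.Theory numFieldNormedType.Exports.
Local Open Scope classical_set_scope.
Local Open Scope ring_scope.

(* Convention: the ambient space R^N is N = n.+1 dimensional, vectors are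
   column vectors 'cV[R]_n.+1, a linear operator is a matrix acting by A *m x. *)

Section Defs.
Variables (R : realType) (n : nat).

(* the j-element subsets of {0,..,n}, indexing the standard basis
   e_{i_1} /\ ... /\ e_{i_j} (i_1 < ... < i_j) of the j-th exterior power *)
Definition jsets (j : nat) : {set {set 'I_n.+1}} := finset (fun S : {set 'I_n.+1} => #|S| == j).

(* the j-th exterior power of R^(n+1), in coordinates w.r.t. that basis *)
Definition ext (j : nat) := 'cV[R]_#|jsets j|.

Definition jsub (j : nat) (k : 'I_#|jsets j|) : {set 'I_n.+1} :=
  enum_val (A := jsets j) k.

(* the a-th smallest element of S (enum S is increasing) *)
Definition sidx (S : {set 'I_n.+1}) (a : nat) : 'I_n.+1 := nth ord0 (enum S) a.

(* x_0 /\ x_1 /\ ... /\ x_{j-1}: its coordinate at S = {i_1<..<i_j} is the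
   j x j minor of the matrix [x_0 ... x_{j-1}] on rows i_1,..,i_j *)
Definition wedge (j : nat) (x : 'I_j -> 'cV[R]_n.+1) : ext j :=
  \col_k \det (\matrix_(a < j, b < j) x b (sidx (jsub k) a) ord0).

Definition iota1 (x : 'cV[R]_n.+1) : ext 1 := wedge (fun _ : 'I_1 => x).

Definition compound (j : nat) (A : 'M[R]_n.+1) : 'M[R]_#|jsets j| :=
  \matrix_(k, l) \det (\matrix_(a < j, b < j)
                         A (sidx (jsub k) a) (sidx (jsub l) b)).

End Defs.

Section Cones.
Variables (R : realType) (m : nat).

Definition negset (K : set 'cV[R]_m) : set 'cV[R]_m := [set x | K (- x)].

Definition proper_cone (K : set 'cV[R]_m) : Prop :=
  [/\ closed K,
      (forall x y, K x -> K y -> K (x + y)),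
      (forall (a : R) x, 0 <= a -> K x -> K (a *: x)),
      (forall x, K x -> K (- x) -> x = 0)
    & interior K !=set0].

Definition Kpositive (K : set 'cV[R]_m) (B : 'M[R]_m) : Prop :=
  forall x, K x -> x != 0 -> interior K (B *m x).

End Cones.

Definition cone_family (R : realType) (n : nat) := forall j : nat, set (ext R n j).

Unset Implicit Arguments.
Section TP.
Variables (R : realType) (n : nat).
Variable K : cone_family R n.

Definition TP_structure : Prop :=
  forall j : nat, (1 <= j <= n.+1)%N -> proper_cone (K j).

Definition GSTP (A : 'M[R]_n.+1) : Prop :=
  forall j : nat, (1 <= j <= n.+1)%N -> Kpositive (K j) (compound j A).

(* one step of the recursive definition of T(K_1,...,K_j), given
   prev i = T(K_1,...,K_i) for i < j *)
Definition Tstep (j : nat) (prev : nat -> set 'cV[R]_n.+1) : set 'cV[R]_n.+1 :=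
  if j is 0 then set0 else
  if j == 1%N then [set x | K 1 (iota1 x) \/ negset (K 1) (iota1 x)]
  else closure [set x | exists y : 'I_j -> 'cV[R]_n.+1,
         [/\ (forall i : 'I_j, nat_of_ord i = 0%N -> y i = x),
             (forall i : 'I_j, (0 < i)%N -> prev (nat_of_ord i) (y i))
           & interior (K j) (wedge y) \/ interior (negset (K j)) (wedge y)]].

Fixpoint Tlist (j : nat) : seq (set 'cV[R]_n.+1) :=
  if j is j'.+1 then rcons (Tlist j') (Tstep j (fun i => nth set0 (Tlist j') i))
  else [:: set0].

(* T j = T(K_1,...,K_j), with T 0 = emptyset *)
Definition T (j : nat) : set 'cV[R]_n.+1 := nth set0 (Tlist j) j.

End TP.

(* Main.v *)
Require Import Defs.
From HB Require Import structures.
From mathcomp Require Import all_boot all_order all_algebra all_fingroup.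
From mathcomp Require Import complex.
From mathcomp Require Import all_classical all_reals topology normedtype sequences.
From mathcomp Require Import ring lra.
Set Implicit Arguments. Unset Strict Implicit. Unset Printing Implicit Defensive.
Import Order.TTheory GRing.Theory Num.Theory numFieldNormedType.Exports.
Local Open Scope classical_set_scope.
Local Open Scope ring_scope.

(** Perron-Frobenius for each compound: Birkhoff's contraction of the cone order
    shows that the normalized powers rho_j^-k C_j(A)^k converge to a rank one
    projection v_j phi_j with v_j interior to K_j and phi_j coercive on K_j.
    Over the complex numbers A is similar to a triangular U, and the diagonal of
    C_j(U)^k consists of the k-th powers of the j-fold products of eigenvalues;
    comparing traces with the limit, exactly one j-fold product equals rho_j and
    all others have smaller modulus.  Exchanging one factor shows that the
    maximizing sets are nested, so the eigenvalues are the ratios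
    rho_(j+1)/rho_j, positive and strictly decreasing.

    By simplicity x_1 /\ ... /\ x_j is a multiple of v_j, hence interior to K_j
    up to sign; with c_p != 0, wedging sum_(i <= p) c_i x_i with
    x_1, ..., x_(p-1) gives the interior claims.  Dually phi_j is a multiple of
    l_1 /\ ... /\ l_j, where the l_i are the eigenbasis coordinates.  If
    y_1 /\ ... /\ y_j lies in +-K_j, Cramer's rule and coercivity of phi_j bound
    all coordinates of y_1 by the first j ones.  This closed condition holds on
    T(K_1, ..., K_j) and excludes the nonzero combinations of x_(j+1), ..., x_n. *)

(** * Vectors and compactness *)

Section Vectors.
Variables (R : realType).

Lemma entry_le_norm m n (M : 'M[R]_(m, n)) i j : `|M i j| <= `|M|.
Proof.
rewrite [leRHS]/Num.norm /= mx_normrE.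
by apply: (le_trans _ (le_bigmax _ _ (i, j))).
Qed.

Lemma norm_le_entries m n (M : 'M[R]_(m, n)) (c : R) :
  0 <= c -> (forall i j, `|M i j| <= c) -> `|M| <= c.
Proof.
move=> c0 Mc; rewrite [leLHS]/Num.norm /= mx_normrE.
by apply/bigmax_leP; split => // -[i j] _; exact: Mc.
Qed.

(** The norm here is the largest absolute entry; this sum is a crude bound for the operator norm it
    induces. *)
Definition mx_l1 m n (M : 'M[R]_(m, n)) : R := \sum_i \sum_j `|M i j|.

Lemma mx_l1_ge0 m n (M : 'M[R]_(m, n)) : 0 <= mx_l1 M.
Proof. by apply: sumr_ge0 => i _; apply: sumr_ge0. Qed.

Lemma norm_mulmx_le m n p (M : 'M[R]_(m, n)) (N : 'M[R]_(n, p)) :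
  `|M *m N| <= mx_l1 M * `|N|.
Proof.
apply: norm_le_entries => [|i j]; first by rewrite mulr_ge0 ?mx_l1_ge0.
rewrite mxE (le_trans (ler_norm_sum _ _ _))//.
rewrite /mx_l1 (bigD1 i)//= mulrDl mulr_suml -[leLHS]addr0 lerD//.
  by apply: ler_sum => k _; rewrite normrM ler_wpM2l// entry_le_norm.
by rewrite mulr_ge0// sumr_ge0// => k _; exact: sumr_ge0.
Qed.

Lemma interior_normP m n (S : set 'M[R]_(m, n)) x :
  interior S x <-> exists2 e, 0 < e & forall y, `|y - x| < e -> S y.
Proof.
split=> [/nbhs_ballP[e e0 eS]|[e e0 eS]].
  by exists e => // y xy; apply: eS; rewrite -ball_normE /= distrC.
by apply/nbhs_ballP; exists e => // y; rewrite -ball_normE /= distrC; exact: eS.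
Qed.

Lemma closure_normP m n (S : set 'M[R]_(m, n)) x :
  closure S x <-> forall e, 0 < e -> exists2 y, S y & `|y - x| < e.
Proof.
split=> [clS e e0|h B /nbhs_ballP[e e0 eB]].
  have [y [Sy]] := clS _ (nbhsx_ballx x e e0).
  by rewrite -ball_normE /= distrC; exists y.
have [y Sy xy] := h e e0.
by exists y; split => //; apply: eB; rewrite -ball_normE /= distrC.
Qed.

(** Heine-Borel for row vectors, carried over by transposition, which does not increase the norm in
    either direction. *)
Lemma compact_colvec n (A : set 'cV[R]_n) :
  bounded_set A -> closed A -> compact A.
Proof.
move=> [M [Mreal AM]] Acl.
pose B := [set x : 'rV[R]_n | A x^T].
have normT k l (x : 'M[R]_(k, l)) : `|x^T| <= `|x|.
  by apply: norm_le_entries => // i j; rewrite mxE entry_le_norm.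
have ctsT k l : continuous (fun x : 'M[R]_(k, l) => x^T).
  move=> x U /nbhs_ballP[e e0 eU]; apply/nbhs_ballP; exists e => //= y.
  rewrite -ball_normE /= => xy; apply: eU; rewrite -ball_normE /=.
  by rewrite -linearB (le_lt_trans (normT _ _ _)).
have -> : A = (fun x : 'rV[R]_n => x^T) @` B.
  apply/seteqP; split => [x Ax|_ [x Bx <-] //].
  by exists x^T; rewrite /B /= ?trmxK.
apply: continuous_compact; first by apply: continuous_subspaceT => x; exact: ctsT.
apply: bounded_closed_compact.
  exists M; split => // r Mr x Ax.
  by have := AM r Mr _ Ax; apply: le_trans; rewrite -{1}[x]trmxK normT.
by apply: (closed_comp _ Acl) => x _; exact: ctsT.
Qed.

(** A Lebesgue number for the compact set [A] inside the open set [O]. *)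
Lemma compact_uniform_radius n (A O : set 'cV[R]_n) :
  compact A -> open O -> A `<=` O ->
  exists2 d, 0 < d & forall x y, A x -> `|y - x| < d -> O y.
Proof.
move=> /compact_near_coveringP cA oO AO.
have [] : \forall e \near 0^'+, A `<=` [set x | forall y, `|y - x| < e -> O y].
  apply: cA => x Ax.
  have /nbhs_ballP[r r0 rO] : nbhs x O by apply: open_nbhs_nbhs; split => //; exact: AO.
  (* One half of the radius is for moving the centre, the other half for the perturbation. *)
  exists (ball x (r / 2), [set e | e < r / 2]).
    split=> /=; first by apply: nbhsx_ballx; rewrite divr_gt0.
    by apply: nbhs_right_lt; rewrite divr_gt0.
  move=> [z e] /= []; rewrite -ball_normE /= => xz er y yz.
  apply: rO; rewrite -ball_normE /= (le_lt_trans (ler_distD z _ _))//.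
  by rewrite [ltRHS]splitr ltrD// distrC (lt_trans yz).
move=> e /= e0 h; exists (e / 2); first by rewrite divr_gt0.
move=> x y Ax; apply: (h (e / 2)) => //=; last by rewrite divr_gt0.
by rewrite sub0r normrN gtr0_norm ?divr_gt0// ltr_pdivrMr// ltr_pMr// ltrDl.
Qed.

End Vectors.

(** * Perron-Frobenius theory of a proper cone *)

(** Convergence is expressed throughout by explicit geometric bounds; this is how they are passed to
    the limit. *)
Lemma le0_geometric (R : realType) (c D eta : R) :
  0 <= eta < 1 -> (forall k, c <= D * eta ^+ k) -> c <= 0.
Proof.
move=> /andP[eta0 eta1] h.
rewrite leNgt; apply/negP => c0.
have lim0 : (fun k => D * eta ^+ k) @ \oo --> D * 0.
  by apply: cvgMr; apply: cvg_expr; rewrite ger0_norm.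
rewrite mulr0 in lim0.
have [k _ /(_ k (leqnn k))] := cvgr_lt _ lim0 _ c0.
by rewrite /= ltNge h.
Qed.

Section Perron.
Variables (R : realType) (m : nat) (K : set 'cV[R]_m) (B : 'M[R]_m).
Hypotheses (Kproper : proper_cone K) (Bpos : Kpositive K B) (m_gt0 : (0 < m)%N).

Let Kclosed : closed K. Proof. by case: Kproper. Qed.
Let KD x y : K x -> K y -> K (x + y).
Proof. by case: Kproper => _ h _ _ _; exact: h. Qed.
Let KZ a x : 0 <= a -> K x -> K (a *: x).
Proof. by case: Kproper => _ _ h _ _; exact: h. Qed.
Let Kpointed x : K x -> K (- x) -> x = 0.
Proof. by case: Kproper => _ _ _ h _; exact: h. Qed.

Lemma cone0 : K 0.
Proof.
by case: Kproper => _ _ _ _ [x /interior_subset Kx]; rewrite -(scale0r x); exact: KZ.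
Qed.

(** If [K] contains the ball of radius [e] around [u], then [u] minus a vector of norm [e / 2] stays
    in [K]; rescaling gives [a = 2 / e]. *)
Lemma order_unit u : interior K u ->
  exists2 a, 0 < a & forall x, K ((a * `|x|) *: u - x).
Proof.
move=> /interior_normP[e e0 eK]; exists (2 / e); first by rewrite divr_gt0.
move=> x; have [->|x0] := eqVneq x 0.
  by rewrite normr0 mulr0 scale0r subr0; exact: cone0.
have nx0 : 0 < `|x| by rewrite normr_gt0.
have -> : (2 / e * `|x|) *: u - x = (2 / e * `|x|) *: (u - (e / 2 / `|x|) *: x).
  rewrite scalerBr scalerA (_ : _ * (_ / _) = 1) ?scale1r//.
  by field; rewrite !gt_eqF.
apply: KZ; first by rewrite !mulr_ge0 ?invr_ge0 ?ltW.
apply: eK; rewrite addrAC subrr add0r normrN normrZ.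
rewrite ger0_norm ?divr_ge0 ?ltW// mulfVK ?gt_eqF//.
by rewrite ltr_pdivrMr// ltr_pMr// ltrDl.
Qed.

(** If [0] were interior, the order unit property would put every vector in [K], against
    pointedness; positive dimension supplies a nonzero vector. *)
Lemma interior_cone_neq0 u : interior K u -> u != 0.
Proof.
move=> /order_unit[a a0 h]; apply/eqP => u0.
have KN x : K (- x) by have := h x; rewrite u0 scaler0 sub0r.
have : const_mx 1 = 0 :> 'cV[R]_m.
  by apply: Kpointed => //; rewrite -[const_mx 1]opprK.
move=> /colP/(_ (Ordinal m_gt0)); rewrite !mxE => /eqP.
by rewrite oner_eq0.
Qed.

Let sphere := [set x | K x /\ `|x| = 1].

Lemma compact_cone_sphere : compact sphere.
Proof.
apply: compact_colvec.
  by exists 1; split => // r r1 x [_ nx] /=; rewrite nx ltW.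
apply: closedI => //.
apply: (@closed_comp _ _ (fun x : 'cV[R]_m => `|x|) [set x | x = 1]).
  by move=> x _; exact: norm_continuous.
exact: closed_eq.
Qed.

(** Normality of the cone. Pointedness keeps the compact set of unit vectors of [K] at a distance
    [d] from [-K]; if [y] were shorter than [d * |x|], then [(x - y) / |x|] would be too close to
    [x / |x|] to lie in [-K]. *)
Lemma cone_normal : exists2 N, 0 < N &
  forall x y, K x -> K (y - x) -> `|x| <= N * `|y|.
Proof.
have [|||d d0 dK] := @compact_uniform_radius _ _ sphere [set x | ~ K (- x)].
- exact: compact_cone_sphere.
- rewrite (_ : [set x | _] = ~` [set x | K (- x)])// openC.
  apply: (@closed_comp _ _ (fun x : 'cV[R]_m => - x) K) => // x _.
  exact: opp_continuous.
- move=> x [Kx nx] KNx; move: nx; rewrite (Kpointed Kx KNx) normr0 => /eqP.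
  by rewrite eq_sym oner_eq0.
exists d^-1; first by rewrite invr_gt0.
move=> x y Kx Kyx; have [->|x0] := eqVneq x 0.
  by rewrite normr0 mulr_ge0 ?invr_ge0 ?(ltW d0).
have nx0 : 0 < `|x| by rewrite normr_gt0.
rewrite mulrC ler_pdivlMr// leNgt mulrC; apply/negP => ynx.
have ix0 : 0 <= `|x|^-1 by rewrite invr_ge0.
apply: (dK (`|x|^-1 *: x) (`|x|^-1 *: (x - y))).
- split; first exact: KZ.
  by rewrite normrZ ger0_norm// mulVf ?gt_eqF.
- rewrite -scalerBr addrAC subrr add0r normrZ normrN ger0_norm//.
  by rewrite mulrC ltr_pdivrMr.
- by rewrite -scalerN opprB; exact: KZ.
Qed.

Lemma mulmx_continuous p q r (M : 'M[R]_(p, q)) :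
  continuous (fun x : 'M[R]_(q, r) => M *m x).
Proof.
move=> x U /nbhs_ballP[e e0 eU]; apply/nbhs_ballP.
have M1 : 0 < mx_l1 M + 1 by rewrite ltr_wpDl ?mx_l1_ge0.
exists (e / (mx_l1 M + 1)); first by rewrite /= divr_gt0.
move=> y; rewrite -ball_normE /= ltr_pdivlMr// => xy.
apply: eU; rewrite -ball_normE /= -mulmxBr (le_lt_trans (norm_mulmx_le _ _))//.
by rewrite (le_lt_trans _ xy)// mulrC ler_wpM2l// lerDl.
Qed.

(** The image of the compact unit sphere of [K] lies in the interior, so one radius [d] fits
    everywhere; homogeneity does the rest. The [+ 1] in the denominator avoids dividing by zero. *)
Lemma Kpositive_uniform u : exists2 e, 0 < e &
  forall x, K x -> K (B *m x - (e * `|x|) *: u).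
Proof.
have [|||d d0 dK] := @compact_uniform_radius _ _
  ((fun x => B *m x) @` sphere) (interior K).
- apply: continuous_compact; last exact: compact_cone_sphere.
  by apply: continuous_subspaceT => x; exact: mulmx_continuous.
- exact: open_interior.
- move=> _ [x [Kx nx] <-]; apply: Bpos => //.
  by rewrite -normr_eq0 nx oner_eq0.
have u1 : 0 < `|u| + 1 by rewrite ltr_wpDl.
exists (d / 2 / (`|u| + 1)); first by rewrite !divr_gt0.
move=> x Kx; have [->|x0] := eqVneq x 0.
  by rewrite normr0 mulr0 scale0r mulmx0 subr0; exact: cone0.
have nx0 : 0 < `|x| by rewrite normr_gt0.
set e := d / 2 / _.
have -> : B *m x - (e * `|x|) *: u =
    `|x| *: (B *m (`|x|^-1 *: x) - e *: u).
  by rewrite scalerBr -scalemxAr !scalerA mulfV ?gt_eqF// scale1r mulrC.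
apply: KZ => //; apply: interior_subset; apply: (dK (B *m (`|x|^-1 *: x))).
  exists (`|x|^-1 *: x) => //; split; first by apply: KZ => //; rewrite invr_ge0.
  by rewrite normrZ ger0_norm ?invr_ge0// mulVf ?gt_eqF.
rewrite addrAC subrr add0r normrN normrZ ger0_norm ?divr_ge0 ?ltW//.
rewrite /e mulrAC ltr_pdivrMr// (@le_lt_trans _ _ (d / 2 * (`|u| + 1)))//.
  by rewrite ler_wpM2l ?divr_ge0 ?ltW// ltrDl.
by rewrite ltr_pM2r// ltr_pdivrMr// ltr_pMr// ltrDl.
Qed.

Lemma Kpositive_mono x : K x -> K (B *m x).
Proof.
move=> Kx; have [->|x0] := eqVneq x 0; first by rewrite mulmx0; exact: cone0.
by apply: interior_subset; exact: Bpos.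
Qed.

(** In the cone order [B p] dominates [e |p| u], while [B y] is dominated by [a L |y| u], so
    [g * a * L <= e] suffices. The cap [g <= 1] keeps the shrunken interval in [Kpositive_contract]
    nonempty. *)
Lemma Kpositive_gain : exists2 g, 0 < g <= 1 & forall p y t,
  K p -> 0 <= t -> t * `|y| <= `|p| -> K (B *m p - (g * t) *: (B *m y)).
Proof.
case: Kproper => _ _ _ _ [u Iu].
have Ku : K u := interior_subset Iu.
have [a a0 aK] := order_unit Iu.
have [e e0 eK] := Kpositive_uniform u.
have L0 := mx_l1_ge0 B; set L := mx_l1 B in L0 *.
have aL : 0 < a * L + 1 by rewrite ltr_wpDl// mulr_ge0// ltW.
pose g := Num.min 1 (e / (a * L + 1)).
have g0 : 0 < g by rewrite lt_min ltr01 divr_gt0.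
exists g; first by rewrite g0 ge_min lexx.
have ge : g * (a * L) <= e.
  have : g <= e / (a * L + 1) by rewrite ge_min lexx orbT.
  rewrite ler_pdivlMr// => h; apply: le_trans h.
  by rewrite ler_wpM2l ?ltW// ltrDl.
move=> p y t Kp t0 typ.
have -> : B *m p - (g * t) *: (B *m y) = (B *m p - (e * `|p|) *: u) +
   ((g * t) *: ((a * `|B *m y|) *: u - B *m y) +
    (e * `|p| - g * t * (a * `|B *m y|)) *: u).
  by apply/colP => i; rewrite !mxE; ring.
apply: KD; first exact: eK.
apply: KD; first by apply: KZ (aK _); rewrite mulr_ge0// ltW.
apply: KZ => //; rewrite subr_ge0.
apply: (@le_trans _ _ (g * (a * L) * (t * `|y|))).
  rewrite (_ : g * t * _ = (g * t * a) * `|B *m y|); last by ring.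
  rewrite (_ : g * (a * L) * _ = (g * t * a) * (L * `|y|)); last by ring.
  by rewrite ler_wpM2l ?norm_mulmx_le// !mulr_ge0// ltW.
by apply: ler_pM => //; rewrite !mulr_ge0 // ltW.
Qed.

(* Birkhoff's contraction: one of the gaps b y - x and x - a y has norm at
   least half of (b - a)|y|, and B turns it into a positive multiple of B y. *)
Lemma Kpositive_contract : exists2 eta, 0 <= eta < 1 & forall (x y : 'cV[R]_m) (a b : R),
  K y -> a <= b -> K (x - a *: y) -> K (b *: y - x) ->
  exists a' b' : R, [/\ a' <= b', b' - a' = eta * (b - a),
    K (B *m x - a' *: (B *m y)) & K (b' *: (B *m y) - B *m x)].
Proof.
have [g /andP[g0 g1] gK] := Kpositive_gain.
exists (1 - g / 2); first by apply/andP; split; lra.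
move=> x y a b Ky ab Kq Kp.
set q := x - _ in Kq; set p := _ - x in Kp; pose t := (b - a) / 2.
have t0 : 0 <= t by rewrite /t; lra.
have : (b - a) * `|y| <= `|p| + `|q|.
  rewrite -[b - a]ger0_norm; last by lra.
  rewrite -normrZ (_ : _ *: y = p + q) ?ler_normD//.
  by rewrite /p /q scalerBl addrA subrK.
move=> pq; have [tp|tp] := lerP (t * `|y|) `|p|.
  exists a, (b - g * t); split.
  - have : g * t <= 1 * t by rewrite ler_wpM2r.
    rewrite /t; lra.
  - by rewrite /t; field.
  - have := Kpositive_mono Kq.
    by rewrite /q mulmxBr -scalemxAr.
  - have := gK p y t Kp t0 tp.
    by rewrite /p mulmxBr -scalemxAr addrAC -scalerBl.
have tq : t * `|y| <= `|q| by rewrite /t in tp *; lra.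
exists (a + g * t), b; split.
- have : g * t <= 1 * t by rewrite ler_wpM2r.
  rewrite /t; lra.
- by rewrite /t; field.
- have := gK q y t Kq t0 tq.
  by rewrite /q mulmxBr -scalemxAr -addrA -opprD -scalerDl.
- have := Kpositive_mono Kp.
  by rewrite /p mulmxBr -scalemxAr.
Qed.

(** In the order of [K] this reads [- c y <= z <= c y]. *)
Definition cone_bounded c y z := K (c *: y - z) /\ K (c *: y + z).

Lemma cone_boundedD c c' y z z' : cone_bounded c y z -> cone_bounded c' y z' ->
  cone_bounded (c + c') y (z + z').
Proof.
move=> [h1 h2] [h3 h4]; split; rewrite scalerDl ?opprD addrACA; exact: KD.
Qed.

Lemma cone_boundedZ a c y z : cone_bounded c y z ->
  cone_bounded (`|a| * c) y (a *: z).
Proof.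
move=> [h1 h2]; split; case: (ger0P a) => a0.
- by rewrite -scalerA -scalerBr; exact: KZ.
- have -> : (- a * c) *: y - a *: z = (- a) *: (c *: y + z).
    by rewrite scalerDr scalerA scaleNr.
  by apply: KZ => //; rewrite oppr_ge0 ltW.
- by rewrite -scalerA -scalerDr; exact: KZ.
- have -> : (- a * c) *: y + a *: z = (- a) *: (c *: y - z).
    by rewrite scalerBr scalerA scaleNr opprK.
  by apply: KZ => //; rewrite oppr_ge0 ltW.
Qed.

Lemma cone_bounded_trans c d w y z : 0 <= c -> cone_bounded c y z ->
  K (d *: w - y) -> cone_bounded (c * d) w z.
Proof.
move=> c0 [h1 h2] h; have {}h := KZ c0 h.
have e : (c * d) *: w = c *: (d *: w - y) + c *: y.
  by rewrite scalerBr scalerA subrK.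
by rewrite /cone_bounded e -!addrA; split; exact: KD.
Qed.

(** Normality applied to [0 <= c y - z <= 2 c y]. *)
Lemma cone_bounded_norm : exists2 N, 0 < N &
  forall c y z, 0 <= c -> cone_bounded c y z -> `|z| <= N * c * `|y|.
Proof.
have [N N0 h] := cone_normal; exists (1 + 2 * N); first by lra.
move=> c y z c0 [h1 h2].
have e : `|c *: y - z| <= N * `|(2 * c) *: y|.
  apply: h => //; rewrite (_ : _ - _ = c *: y + z)//.
  by apply/colP => i; rewrite !mxE; ring.
rewrite normrZ ger0_norm ?mulr_ge0// in e.
have : `|z| <= `|c *: y| + `|c *: y - z|.
  by rewrite -{1}(subKr (c *: y) z) ler_normB.
rewrite normrZ ger0_norm// => {}h; apply: (le_trans h); lra.
Qed.

(** * Asymptotic ratios along the orbit of an interior vector *)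

Variable u : 'cV[R]_m.
Hypothesis Iu : interior K u.

Let orb k := B ^+ k *m u.

Lemma expr_mulmxS k (x : 'cV[R]_m) : B ^+ k.+1 *m x = B *m (B ^+ k *m x).
Proof. by rewrite exprS mulmxA. Qed.

Lemma expr_mulmxSr k (x : 'cV[R]_m) : B ^+ k.+1 *m x = B ^+ k *m (B *m x).
Proof. by rewrite exprSr -mulmxA. Qed.

Lemma expr_mulmxD k l (x : 'cV[R]_m) :
  B ^+ (k + l) *m x = B ^+ k *m (B ^+ l *m x).
Proof. by rewrite exprD -mulmxA. Qed.

Lemma orbit_interior k : interior K (orb k).
Proof.
elim: k => [|k ih]; first by rewrite /orb expr0 mul1mx.
rewrite /orb expr_mulmxS; apply: Bpos; last exact: interior_cone_neq0.
exact: interior_subset.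
Qed.

Let Korb k : K (orb k). Proof. exact: interior_subset (orbit_interior k). Qed.

Lemma orbit_scale_ge0 k s : K (s *: orb k) -> 0 <= s.
Proof.
move=> h; rewrite leNgt; apply/negP => s0.
have /eqP := interior_cone_neq0 (orbit_interior k); apply.
apply: Kpointed => //.
have -> : - orb k = (- s)^-1 *: (s *: orb k).
  by rewrite scalerA invrN mulNr mulVf ?lt_eqF// scaleN1r.
by apply: KZ => //; rewrite invr_ge0 oppr_ge0 ltW.
Qed.

Lemma Kpositive_expr k x : K x -> K (B ^+ k *m x).
Proof.
move=> Kx; elim: k => [|k ih]; first by rewrite expr0 mul1mx.
by rewrite expr_mulmxS; exact: Kpositive_mono.
Qed.

(** Pushed to the common time [k + k'] and added, the two inequalities lose [x]. So lower ratios at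
    any time lie below upper ratios at any other time. *)
Lemma orbit_ratio_bound k k' t b x :
  K (B ^+ k *m x - t *: orb k) -> K (b *: orb k' - B ^+ k' *m x) -> t <= b.
Proof.
move=> /(Kpositive_expr k') h1 /(Kpositive_expr k) h2.
rewrite -subr_ge0; apply: (@orbit_scale_ge0 (k + k')); move: (KD h1 h2).
rewrite /orb !mulmxBr -!scalemxAr -!expr_mulmxD addnC.
by rewrite scalerBl addrC addrA subrK.
Qed.

Variable eta : R.
Hypothesis eta01 : 0 <= eta < 1.
Hypothesis etaP : forall (x y : 'cV[R]_m) (a b : R),
  K y -> a <= b -> K (x - a *: y) -> K (b *: y - x) ->
  exists a' b' : R, [/\ a' <= b', b' - a' = eta * (b - a),
    K (B *m x - a' *: (B *m y)) & K (b' *: (B *m y) - B *m x)].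

(** [f] is the value at [x] of the Perron functional normalized to 1 at [u]; the error is measured
    in the cone order, relative to the orbit of [u]. *)
Definition asymptotic x f := exists2 D, 0 <= D &
  forall k, cone_bounded (D * eta ^+ k) (orb k) (B ^+ k *m x - f *: orb k).

Lemma asymptotic_exists x : exists f, asymptotic x f.
Proof.
have [a a0 aK] := order_unit Iu.
pose C := a * `|x|.
have C0 : 0 <= C by rewrite mulr_ge0// ltW.
have step k : exists s t, [/\ s <= t, t - s = 2 * C * eta ^+ k,
    K (B ^+ k *m x - s *: orb k) & K (t *: orb k - B ^+ k *m x)].
  elim: k => [|k [s [t [st e h1 h2]]]].
    exists (- C), C; rewrite /orb !expr0 !mul1mx; split.
    - by lra.
    - by lra.
    - by have := aK (- x); rewrite normrN opprK scaleNr opprK addrC.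
    - exact: aK.
  have [s' [t' [st' e' h1' h2']]] := etaP (Korb k) st h1 h2.
  exists s', t'; split => //.
  - by rewrite e' e exprS; ring.
  - by rewrite /orb !expr_mulmxS.
  - by rewrite /orb !expr_mulmxS.
(* The lower ratios of all times are collected, so that the supremum lies in every interval
   [[s, t]], whose length shrinks like [eta ^+ k]. *)
pose E := [set t | exists k, K (B ^+ k *m x - t *: orb k)].
have supE : has_sup E.
  split; first by have [s [t [_ _ h _]]] := step 0; exists s, 0.
  have [s [t [_ _ _ h]]] := step 0.
  by exists t => r [k hk]; exact: orbit_ratio_bound hk h.
exists (sup E), (2 * C); first by rewrite mulr_ge0.
move=> k; have [s [t [st e h1 h2]]] := step k.
have sE : s <= sup E by apply: ub_le_sup; [case: supE|exists k].
have Et : sup E <= t.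
  by apply: ge_sup; [case: supE|move=> r [k' hk']; exact: orbit_ratio_bound hk' h2].
split.
  rewrite [X in K X](_ : _ = (t *: orb k - B ^+ k *m x) + (sup E - s) *: orb k).
    by apply: KD => //; apply: KZ => //; rewrite subr_ge0.
  by rewrite -e; apply/colP => i; rewrite !mxE; ring.
rewrite [X in K X](_ : _ = (B ^+ k *m x - s *: orb k) + (t - sup E) *: orb k).
  by apply: KD => //; apply: KZ => //; rewrite subr_ge0.
by rewrite -e; apply/colP => i; rewrite !mxE; ring.
Qed.

Lemma asymptotic_lin a x x' f f' : asymptotic x f -> asymptotic x' f' ->
  asymptotic (a *: x + x') (a * f + f').
Proof.
move=> [D D0 h] [D' D0' h']; exists (`|a| * D + D').
  by rewrite addr_ge0// mulr_ge0.
move=> k; rewrite mulrDl -mulrA.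
rewrite (_ : _ - _ = a *: (B ^+ k *m x - f *: orb k) + (B ^+ k *m x' - f' *: orb k)).
  by apply: cone_boundedD => //; exact: cone_boundedZ.
rewrite mulmxDr -scalemxAr scalerDl scalerBr -scalerA opprD; exact: addrACA.
Qed.

Lemma asymptotic_scale f : asymptotic (f *: u) f.
Proof.
exists 0 => // k; rewrite mul0r -scalemxAr subrr /cone_bounded scale0r subr0 addr0.
by split; exact: cone0.
Qed.

Lemma asymptotic_ge0 x f : K x -> asymptotic x f -> 0 <= f.
Proof.
move=> Kx [D D0 h]; rewrite -oppr_le0; apply: (le0_geometric (D := D) eta01) => k.
rewrite -subr_ge0 opprK; apply: (@orbit_scale_ge0 k).
have [h1 _] := h k; have := KD h1 (Kpositive_expr k Kx).
by rewrite opprB addrA subrK -scalerDl.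
Qed.

(** By linearity only ratios of [0] matter, and since [0] lies in [K], [asymptotic_ge0] applies to
    such a ratio and to its opposite. *)
Lemma asymptotic_unique x f f' : asymptotic x f -> asymptotic x f' -> f = f'.
Proof.
have key g : asymptotic 0 g -> g = 0.
  move=> ag; apply/eqP; rewrite eq_le (asymptotic_ge0 cone0 ag) andbT.
  have := asymptotic_lin (-1) ag ag; rewrite scaler0 addr0.
  rewrite -oppr_ge0 => h; apply: (asymptotic_ge0 cone0).
  have := asymptotic_lin (-1) ag (asymptotic_scale 0).
  by rewrite scaler0 scale0r !addr0 mulN1r.
move=> h1 h2; apply/eqP; rewrite -subr_eq0; apply/eqP/key.
have := asymptotic_lin (-1) h2 h1.
by rewrite scaleN1r addNr mulN1r addrC.
Qed.

Lemma asymptotic_row : exists phi : 'rV[R]_m,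
  forall x, asymptotic x ((phi *m x) 0 0).
Proof.
have [f fP] := choice (fun i : 'I_m => asymptotic_exists (delta_mx i 0)).
exists (\row_i f i) => x.
rewrite [X in asymptotic X _](_ : _ = \sum_i x i 0 *: delta_mx i 0); last first.
  by rewrite [LHS]matrix_sum_delta; apply: eq_bigr => i _; rewrite big_ord1.
rewrite mxE (eq_bigr (fun i => x i 0 * f i)); last first.
  by move=> i _; rewrite mxE mulrC.
elim/big_rec2: _ => [|i y1 y2 _ ih]; last exact: asymptotic_lin.
by have := asymptotic_scale 0; rewrite scale0r.
Qed.

(** [B ^+ k.+1 *m x] is compared with [f *: orb k.+1], and [orb k.+1] with [rho *: orb k]. This
    makes the functional a left eigenvector of [B]. *)
Lemma asymptotic_mulmx x f rho : asymptotic x f -> asymptotic (B *m u) rho ->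
  asymptotic (B *m x) (f * rho).
Proof.
move=> [D D0 h] [D' D0' h'].
have /andP[eta0 eta1] := eta01.
exists (D * eta * (D' + `|rho|) + `|f| * D').
  by rewrite addr_ge0// ?mulr_ge0// addr_ge0.
move=> k; rewrite -expr_mulmxSr mulrDl -[`|f| * D' * _]mulrA.
have -> : B ^+ k.+1 *m x - (f * rho) *: orb k =
    (B ^+ k.+1 *m x - f *: orb k.+1) + f *: (B ^+ k *m (B *m u) - rho *: orb k).
  by rewrite -expr_mulmxSr scalerBr scalerA addrA subrK.
apply: cone_boundedD; last by apply: cone_boundedZ; exact: h'.
have -> : D * eta * (D' + `|rho|) * eta ^+ k =
    D * eta ^+ k.+1 * (D' + `|rho|) by rewrite exprS; ring.
apply: cone_bounded_trans (h k.+1) _; first by rewrite mulr_ge0 ?exprn_ge0.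
have [h1 _] := h' k.
have -> : (D' + `|rho|) *: orb k - orb k.+1 =
  ((D' * eta ^+ k) *: orb k - (B ^+ k *m (B *m u) - rho *: orb k)) +
  (D' * (1 - eta ^+ k) + (`|rho| - rho)) *: orb k.
  by rewrite -expr_mulmxSr /orb; apply/colP => i; rewrite !mxE; ring.
apply: KD => //; apply: KZ => //; rewrite addr_ge0//.
  by rewrite mulr_ge0// subr_ge0 exprn_ile1// ltW.
by rewrite subr_ge0 ler_norm.
Qed.

End Perron.

(** [perron_dual] makes [v *m phi] a projection, the limit in [perron_cvg]; [perron_coercive] says
    that [phi] is interior to the dual cone. *)
Record perron_triple (R : realType) (m : nat) (K : set 'cV[R]_m) (B : 'M[R]_m)
    (rho : R) (v : 'cV[R]_m) (phi : 'rV[R]_m) : Prop := PerronTriple {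
  perron_gt0 : 0 < rho;
  perron_left : phi *m B = rho *: phi;
  perron_dual : (phi *m v) 0 0 = 1;
  perron_interior : interior K v;
  perron_coercive : exists2 c, 0 < c & forall x, K x -> c * `|x| <= (phi *m x) 0 0;
  perron_cvg : exists eta E, 0 <= eta < 1 /\
    forall k, `|(rho ^+ k)^-1 *: (B ^+ k) - v *m phi| <= E * eta ^+ k }.

Lemma perron (R : realType) (m : nat) (K : set 'cV[R]_m) (B : 'M[R]_m) :
  (0 < m)%N -> proper_cone K -> Kpositive K B ->
  exists rho v phi, perron_triple K B rho v phi.
Proof.
move=> m_gt0 Kp Bpos.
have [Kclosed KD KZ Kpointed Kint] := Kp.
have [u Iu] : exists u : 'cV[R]_m, interior K u by [].
have [eta eta01 etaP] := Kpositive_contract Kp Bpos.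
pose orb k := B ^+ k *m u.
have [phi phiP] := asymptotic_row Kp Bpos m_gt0 Iu etaP.
have uniq := @asymptotic_unique _ _ _ _ Kp Bpos m_gt0 _ Iu _ eta01.
pose rho := (phi *m (B *m u)) 0 0.
have phiB (x : 'cV[R]_m) : (phi *m (B *m x)) 0 0 = rho * (phi *m x) 0 0.
  rewrite mulrC; apply: (uniq (B *m x)); first exact: phiP.
  exact: (asymptotic_mulmx Kp Bpos m_gt0 Iu eta01).
have phiu : (phi *m u) 0 0 = 1.
  apply: (uniq u); first exact: phiP.
  by have := asymptotic_scale B Kp u eta 1; rewrite scale1r.
have phi_lin (a : R) (x y : 'cV[R]_m) :
    (phi *m (a *: x + y)) 0 0 = a * (phi *m x) 0 0 + (phi *m y) 0 0.
  by rewrite mulmxDr -scalemxAr mxE [in X in X + _]mxE.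
have [e e0 eK] := Kpositive_uniform Kp Bpos u.
(* The functional is nonnegative on the cone, in particular at [B *m x - (e * |x|) *: u]. *)
have coer x : K x -> e * `|x| <= rho * (phi *m x) 0 0.
  move=> Kx; rewrite -phiB -subr_ge0.
  have -> : (phi *m (B *m x)) 0 0 - e * `|x| =
      (phi *m (B *m x - (e * `|x|) *: u)) 0 0.
    by rewrite [in RHS]addrC -[in RHS]scaleNr phi_lin phiu mulr1 addrC.
  exact: (asymptotic_ge0 Kp Bpos m_gt0 Iu eta01 (eK x Kx)).
have rho0 : 0 < rho.
  have := coer u (interior_subset Iu); rewrite phiu mulr1; apply: lt_le_trans.
  by rewrite mulr_gt0// normr_gt0 (interior_cone_neq0 Kp m_gt0 Iu).
have phiBE : phi *m B = rho *: phi.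
  apply/rowP => j; have := phiB (delta_mx j 0).
  by rewrite mulmxA -!colE mxE => ->; rewrite !mxE.
have phiorb k : (phi *m orb k) 0 0 = rho ^+ k.
  elim: k => [|k ih]; first by rewrite /orb !expr0 mul1mx.
  by rewrite /orb expr_mulmxS phiB ih exprS.
have Korb k : K (orb k) by apply: (Kpositive_expr Kp Bpos); exact: interior_subset.
have orbn k : `|orb k| <= rho / e * rho ^+ k.
  have := coer _ (Korb k); rewrite phiorb mulrAC ler_pdivlMr// => h.
  by rewrite mulrC.
have [N N0 NP] := cone_bounded_norm Kp.
have decay (x : 'cV[R]_m) : (phi *m x) 0 0 = 0 ->
    exists E, forall k, `|(rho ^+ k)^-1 *: (B ^+ k *m x)| <= E * eta ^+ k.
  move=> phix; have [D D0 h] := phiP x; exists (N * D * (rho / e)) => k.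
  have := h k; rewrite phix scale0r subr0 => /NP.
  have eta0 : 0 <= eta ^+ k by apply: exprn_ge0; case/andP: eta01.
  have rk : 0 < rho ^+ k by rewrite exprn_gt0.
  move=> /(_ (mulr_ge0 D0 eta0)) hk.
  rewrite normrZ [ `|_^-1| ]gtr0_norm ?invr_gt0//.
  rewrite ler_pdivrMl//.
  rewrite (le_trans hk)// [leRHS](_ : _ =
     N * (D * eta ^+ k) * (rho / e * rho ^+ k)); last by ring.
  apply: ler_wpM2l (orbn k); apply: mulr_ge0; first exact: ltW.
  exact: mulr_ge0.
(* The left eigenvector makes [rho] an eigenvalue, so a right eigenvector [w^T] exists. If [phi]
   killed it, [decay] would force it to vanish; hence it can be normalized. *)
have [v Bv phiv] : exists2 v : 'cV[R]_m, B *m v = rho *: v & (phi *m v) 0 0 = 1.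
  have : \det (B - rho%:M)^T = 0.
    rewrite det_tr; apply/eqP/det0P; exists phi.
      by apply/eqP => phi0; move: phiu; rewrite phi0 mul0mx mxE => /eqP; rewrite eq_sym oner_eq0.
    by rewrite mulmxBr phiBE mul_mx_scalar subrr.
  move=> /eqP/det0P[w w0 wB].
  have Bw : B *m w^T = rho *: w^T.
    apply/eqP; rewrite -subr_eq0 -mul_scalar_mx -mulmxBl -[X in X == 0]trmxK.
    by rewrite trmx_mul trmxK wB trmx0.
  have phiw : (phi *m w^T) 0 0 != 0.
    apply/eqP => phiw; have [E EP] := decay _ phiw.
    suff : `|w^T| <= 0.
      by rewrite normr_le0 -[w^T]trmxK trmxK -trmx0 (inj_eq trmx_inj) (negPf w0).
    apply: (le0_geometric (D := E) eta01) => k; apply: le_trans (EP k).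
    suff -> : B ^+ k *m w^T = rho ^+ k *: w^T.
      by rewrite scalerA mulVf ?scale1r// expf_neq0// gt_eqF.
    elim: k => [|k ih]; first by rewrite !expr0 mul1mx scale1r.
    by rewrite expr_mulmxS ih -scalemxAr Bw scalerA -exprSr.
  exists (((phi *m w^T) 0 0)^-1 *: w^T).
    by rewrite -scalemxAr Bw !scalerA mulrC.
  by rewrite -scalemxAr mxE mulVf.
have Bkv k : B ^+ k *m v = rho ^+ k *: v.
  elim: k => [|k ih]; first by rewrite !expr0 mul1mx scale1r.
  by rewrite expr_mulmxS ih -scalemxAr Bv scalerA -exprSr.
(* Split [x] into [(phi x) v] and a part in the kernel of [phi], where [decay] applies. *)
have cvgx (x : 'cV[R]_m) : exists E, forall k,
    `|(rho ^+ k)^-1 *: (B ^+ k *m x) - (phi *m x) 0 0 *: v| <= E * eta ^+ k.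
  have [|E EP] := decay (- (phi *m x) 0 0 *: v + x).
    by rewrite phi_lin phiv mulr1 addNr.
  exists E => k; apply: le_trans (EP k).
  rewrite mulmxDr -scalemxAr Bkv [_ *: (_ *: v)]scalerA mulNr scaleNr mulrC.
  rewrite scalerDr scalerN !scalerA mulrA mulVf ?expf_neq0 ?gt_eqF// mul1r.
  by rewrite [X in _ <= `|X|]addrC.
(* [v] is the limit of the normalized orbit of [u], and [K] is closed. *)
have Kv : K v.
  apply: Kclosed; apply/closure_normP => r r0; have [E EP] := cvgx u.
  apply: contrapT => h.
  suff : r <= 0 by rewrite leNgt r0.
  apply: (le0_geometric (D := E) eta01) => k; apply: le_trans (EP k).
  rewrite phiu scale1r leNgt; apply/negP => rk; apply: h.
  exists ((rho ^+ k)^-1 *: (B ^+ k *m u)) => //.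
  by apply: KZ (Korb k); rewrite invr_ge0 exprn_ge0// ltW.
exists rho, v, phi; split => //.
(* [B *m v = rho *: v] is interior by positivity, and a ball around it scales back to one around
   [v]. *)
- have v0 : v != 0.
    by apply/eqP => v0; move: phiv; rewrite v0 mulmx0 mxE => /eqP; rewrite eq_sym oner_eq0.
  have /interior_normP[r r0 rK] := Bpos _ Kv v0.
  apply/interior_normP; exists (r / rho); first by rewrite divr_gt0.
  move=> y; rewrite ltr_pdivlMr// => yv.
  rewrite -[y]scale1r -(mulVf (lt0r_neq0 rho0)) -scalerA.
  apply: KZ; first by rewrite invr_ge0 ltW.
  by apply: rK; rewrite Bv -scalerBr normrZ gtr0_norm// mulrC.
- exists (e / rho); first by rewrite divr_gt0.
  by move=> x Kx; rewrite mulrAC ler_pdivrMr// [leRHS]mulrC coer.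
- have [E EP] := choice (fun j : 'I_m => cvgx (delta_mx j 0)).
  exists eta, (\sum_j `|E j|); split => // k.
  have ek : 0 <= eta ^+ k by apply: exprn_ge0; case/andP: eta01.
  apply: norm_le_entries => [|i j]; first by rewrite mulr_ge0// sumr_ge0.
  pose d : 'cV[R]_m := delta_mx j 0.
  have := entry_le_norm ((rho ^+ k)^-1 *: (B ^+ k *m d) - (phi *m d) 0 0 *: v) i 0.
  move=> /le_trans/(_ (EP j k)); rewrite /d -!colE !mxE big_ord1 [v i 0 * _]mulrC => h.
  rewrite (le_trans h)// ler_wpM2r// (le_trans (ler_norm _))//.
  by rewrite (bigD1 j)//= lerDl sumr_ge0.
Qed.

(** * Compound matrices and the Cauchy-Binet formula *)

Section CauchyBinet.
Variables (n j : nat).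
Local Notation N := n.+1.
Local Notation I := 'I_#|jsets n j|.

Lemma card_jsub (k : I) : #|jsub k| = j.
Proof. by have := enum_valP k; rewrite inE => /eqP. Qed.

Definition jidx (k : I) (a : 'I_j) : 'I_N := sidx (jsub k) a.

Lemma jidx_inj k : injective (jidx k).
Proof.
move=> a b /eqP; rewrite nth_uniq ?enum_uniq -?cardE ?card_jsub// => /eqP.
exact: val_inj.
Qed.

Lemma jidx_in k a : jidx k a \in jsub k.
Proof. by rewrite -mem_enum mem_nth// -cardE card_jsub. Qed.

Lemma jsub_jidx k : jsub k = [set jidx k a | a : 'I_j]%SET.
Proof.
apply/esym/eqP; rewrite eqEcard card_imset; last exact: jidx_inj.
rewrite card_ord card_jsub leqnn andbT; apply/fintype.subsetP => _ /imsetP[a _ ->].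
exact: jidx_in.
Qed.

(** An injective map into the index set is the increasing enumeration of its image precomposed with
    a permutation. *)
Definition jarr (ks : I * 'S_j) : {ffun 'I_j -> 'I_N} :=
  [ffun a => jidx ks.1 (ks.2 a)].

Lemma jarr_inj : injective jarr.
Proof.
move=> [k s] [k' s'] /= /ffunP e.
have {}e a : jidx k (s a) = jidx k' (s' a) by have := e a; rewrite !ffunE.
have kk : k = k'.
  apply: enum_val_inj; change (jsub k = jsub k'); rewrite !jsub_jidx.
  apply/setP => x; apply/imsetP/imsetP => -[a _ ->].
    by exists (s' (s^-1%g a)) => //; rewrite -e permKV.
  by exists (s (s'^-1%g a)) => //; rewrite e permKV.
rewrite -kk in e *; congr pair; apply/permP => a; exact: jidx_inj (e a).
Qed.

(** Surjectivity by counting: both sides have binomial(N, j) times j! elements. *)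
Lemma jarr_image : [set jarr ks | ks : I * 'S_j]%SET =
  [set f : {ffun 'I_j -> 'I_N} | injectiveb f]%SET.
Proof.
apply/eqP; rewrite eqEcard; apply/andP; split.
  apply/fintype.subsetP => _ /imsetP[[k s] _ ->]; rewrite inE; apply/injectiveP => a b.
  by rewrite !ffunE /= => /jidx_inj/perm_inj.
rewrite card_inj_ffuns card_imset; last exact: jarr_inj.
rewrite card_prod !card_ord card_Sn /jsets card_draws card_ord.
by rewrite bin_ffact.
Qed.

Variable R : comPzRingType.

Lemma det_mulmx_ffun (X : 'M[R]_(j, N)) (Y : 'M[R]_(N, j)) :
  \det (X *m Y) =
  \sum_(f : {ffun 'I_j -> 'I_N}) (\prod_a X a (f a)) * \det (rowsub f Y).
Proof.
transitivity (\sum_(s : 'S_j) \sum_(f : {ffun 'I_j -> 'I_N})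
   (\prod_a X a (f a)) * ((-1) ^+ s * \prod_a Y (f a) (s a))).
  apply: eq_bigr => s _.
  rewrite (eq_bigr (fun a => \sum_l X a l * Y l (s a))); last first.
    by move=> a _; rewrite mxE.
  rewrite bigA_distr_bigA /= big_distrr /=; apply: eq_bigr => f _.
  by rewrite big_split /= mulrCA.
rewrite exchange_big /=; apply: eq_bigr => f _.
rewrite -big_distrr /=; congr (_ * _); apply: eq_bigr => s _; congr (_ * _).
by apply: eq_bigr => a _; rewrite mxE.
Qed.

(** In the expansion over all index maps, those that are not injective repeat a row of [Y]. The
    others are grouped by image, and the permutation signs rebuild the minor of [X]. *)
Lemma Cauchy_Binet (X : 'M[R]_(j, N)) (Y : 'M[R]_(N, j)) :
  \det (X *m Y) =
  \sum_(k : I) \det (colsub (jidx k) X) * \det (rowsub (jidx k) Y).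
Proof.
rewrite det_mulmx_ffun (bigID (fun f : {ffun _} => injectiveb f)) /=.
rewrite [X in _ + X]big1 ?addr0; last first.
  move=> f /injectivePn[a [b ab fab]].
  rewrite (determinant_alternate ab) ?mulr0// => c; by rewrite !mxE fab.
rewrite (eq_bigl (mem [set jarr ks | ks : I * 'S_j]%SET)); last first.
  by move=> f; rewrite jarr_image /= inE.
rewrite big_imset /=; last by move=> x y _ _; exact: jarr_inj.
rewrite (eq_bigl xpredT)//.
rewrite -(pair_big xpredT xpredT (fun k s => (\prod_a X a (jarr (k, s) a)) *
   \det (rowsub (jarr (k, s)) Y))) /=.
apply: eq_bigr => k _; rewrite /determinant big_distrl /=.
apply: eq_bigr => s _.
have -> : rowsub (jarr (k, s)) Y = row_perm s (rowsub (jidx k) Y).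
  by apply/matrixP => a b; rewrite !mxE ffunE.
rewrite -/(\det _) row_permE det_mulmx det_perm mulrCA mulrA; congr (_ * _ * _).
by apply: eq_bigr => a _; rewrite !mxE ffunE.
Qed.

(* [compound] and [wedge] over an arbitrary commutative ring, since the
   triangularization below takes place over R[i]. *)
Definition cpd (A : 'M[R]_N) : 'M[R]_#|jsets n j| :=
  \matrix_(k, l) \det (mxsub (jidx k) (jidx l) A).

Definition wdg (Y : 'M[R]_(N, j)) : 'cV[R]_#|jsets n j| :=
  \col_k \det (rowsub (jidx k) Y).

Lemma cpd_wdg A Y : cpd A *m wdg Y = wdg (A *m Y).
Proof.
apply/colP => k; rewrite !mxE.
rewrite (_ : rowsub _ _ = rowsub (jidx k) A *m Y); last by rewrite mul_rowsub_mx.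
rewrite Cauchy_Binet; apply: eq_bigr => l _; rewrite !mxE; congr (\det _ * _).
by apply/matrixP => a b; rewrite !mxE.
Qed.

Lemma cpdM A B : cpd (A *m B) = cpd A *m cpd B.
Proof.
apply/matrixP => k l; rewrite !mxE.
rewrite (_ : mxsub _ _ _ = rowsub (jidx k) A *m colsub (jidx l) B); last first.
  by apply/matrixP => a b; rewrite !mxE; apply: eq_bigr => i _; rewrite !mxE.
rewrite Cauchy_Binet; apply: eq_bigr => i _; rewrite !mxE; congr (_ * _).
  by congr (\det _); apply/matrixP => a b; rewrite !mxE.
by congr (\det _); apply/matrixP => a b; rewrite !mxE.
Qed.

End CauchyBinet.

Section Compounds.
Variables (n j : nat).
Local Notation N := n.+1.
Local Notation I := 'I_#|jsets n j|.

Lemma jidx_mono (k : I) (a b : 'I_j) : (a < b)%N -> (jidx k a < jidx k b)%N.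
Proof.
move=> ab.
have tr : transitive (relpre (val : 'I_N -> nat) ltn).
  by move=> x y z; exact: ltn_trans.
have S : sorted (relpre (val : 'I_N -> nat) ltn) (enum (jsub k)).
  apply: sorted_filter => //.
  by rewrite -sorted_map -enumT val_enum_ord iota_ltn_sorted.
by apply: (sorted_ltn_nth tr ord0 S) => //; rewrite inE -cardE card_jsub.
Qed.

Variable R : comNzRingType.

Lemma prod_jidx (k : I) (F : 'I_N -> R) :
  \prod_(a < j) F (jidx k a) = \prod_(i in jsub k) F i.
Proof.
rewrite [in RHS]jsub_jidx big_imset //=.
by move=> a b _ _; exact: jidx_inj.
Qed.

Lemma cpd1 : cpd j (1%:M : 'M[R]_N) = 1%:M.
Proof.
apply/matrixP => k l; rewrite !mxE; have [<-|kl] := eqVneq k l.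
  rewrite (_ : mxsub _ _ _ = 1%:M) ?det1//.
  by apply/matrixP => a b; rewrite !mxE (inj_eq (@jidx_inj _ _ k)).
(* Distinct sets of equal size: an element of [jsub k] outside [jsub l] gives a zero row of the
   minor. *)
have [a ak] : exists a, jidx k a \notin jsub l.
  apply/existsP; rewrite -negb_forall; apply: contra kl => /forallP h.
  apply/eqP/enum_val_inj; change (jsub k = jsub l).
  apply/eqP; rewrite eqEcard !card_jsub leqnn andbT.
  by rewrite jsub_jidx; apply/fintype.subsetP => _ /imsetP[a _ ->]; exact: h.
rewrite (expand_det_row _ a) big1// => b _; rewrite !mxE.
case: eqP => [e|_]; last by rewrite mul0r.
by move: ak; rewrite e jidx_in.
Qed.

Lemma cpdX (A : 'M[R]_N) m : cpd j (A ^+ m) = cpd j A ^+ m.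
Proof.
elim: m => [|m ih]; first by rewrite !expr0; exact: cpd1.
by rewrite !exprS -ih; exact: cpdM.
Qed.

(** Since [jidx k] is increasing, the principal submatrix is again triangular. *)
Lemma cpd_trig_diag (U : 'M[R]_N) (k : I) : is_trig_mx U ->
  cpd j U k k = \prod_(i in jsub k) U i i.
Proof.
move=> /is_trig_mxP trU; rewrite mxE det_trig.
  by rewrite -prod_jidx; apply: eq_bigr => a _; rewrite !mxE.
by apply/is_trig_mxP => a b ab; rewrite mxE trU// jidx_mono.
Qed.

End Compounds.

Lemma map_cpd (R R' : comNzRingType) (f : {rmorphism R -> R'}) n j (A : 'M[R]_n.+1) :
  map_mx f (cpd j A) = cpd j (map_mx f A).
Proof. by apply/matrixP => k l; rewrite !mxE -det_map_mx map_mxsub. Qed.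

Lemma trig_mulmx (R : comNzRingType) n (U V : 'M[R]_n) :
  is_trig_mx U -> is_trig_mx V ->
  is_trig_mx (U *m V) /\ forall i, (U *m V) i i = U i i * V i i.
Proof.
move=> /is_trig_mxP trU /is_trig_mxP trV; split.
  apply/is_trig_mxP => i j ij; rewrite mxE big1// => l _.
  have [il|li] := ltnP i l; first by rewrite trU ?mul0r.
  by rewrite trV ?mulr0// (leq_ltn_trans li).
move=> i; rewrite mxE (bigD1 i)//= big1 ?addr0// => l li.
have [il|il|e] := ltngtP i l; first by rewrite trU ?mul0r.
  by rewrite trV ?mulr0.
by move: li; rewrite -val_eqE /= -e eqxx.
Qed.

Lemma trig_expr (R : comNzRingType) n (U : 'M[R]_n.+1) m : is_trig_mx U ->
  is_trig_mx (U ^+ m) /\ forall i, (U ^+ m) i i = U i i ^+ m.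
Proof.
move=> trU; elim: m => [|m [ih1 ih2]].
  by rewrite expr0; split=> [|i]; [exact: scalar_mx_is_trig|rewrite mxE eqxx].
rewrite exprS; have [h1 h2] := trig_mulmx trU ih1; split => // i.
by rewrite (h2 i) ih2 exprS.
Qed.

Lemma char_poly_conj (F : fieldType) n (P A : 'M[F]_n) : P \in unitmx ->
  char_poly (P *m A *m invmx P) = char_poly A.
Proof.
move=> Pu; pose p := map_mx (@polyC F) P; pose q := map_mx (@polyC F) (invmx P).
have pq : p *m q = 1%:M by rewrite -map_mxM mulmxV// map_mx1.
have -> : char_poly (P *m A *m invmx P) = \det (p *m char_poly_mx A *m q).
  rewrite /char_poly /char_poly_mx mulmxBr mulmxBl !map_mxM; congr (\det (_ - _)).
  by rewrite scalar_mxC -mulmxA pq mulmx1.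
by rewrite !det_mulmx mulrC mulrA -det_mulmx (mulmx1C pq) det1 mul1r.
Qed.

(** * Geometrically convergent powers of a complex number *)

Section ComplexPowers.
Variable R : realType.
Local Notation C := R[i]%C.
Local Notation toC := (real_complex R).

Lemma norm_toC (x : R) : `|toC x| = toC `|x|.
Proof. by rewrite normc_def /= expr0n addr0 sqrtr_sqr. Qed.

Lemma eq0_geometricC (z : C) (D eta : R) : 0 <= eta < 1 ->
  (forall k, `|z| <= toC (D * eta ^+ k)) -> z = 0.
Proof.
move=> eta01 h; apply/eqP; rewrite -normr_le0 normc_def -(rmorph0 toC) lecR.
by apply: (le0_geometric (D := D) eta01) => k; rewrite -lecR -normc_def.
Qed.

(** The limit satisfies [z * q = q]. If [q] is nonzero then [z = 1]; if [q = 0] then [|z| >= 1]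
    would keep the powers away from it. *)
Lemma powers_cvgC (z q : C) (D eta : R) : 0 <= eta < 1 ->
  (forall k, `|z ^+ k - q| <= toC (D * eta ^+ k)) ->
  (z = 1 /\ q = 1) \/ (`|z| < 1 /\ q = 0).
Proof.
move=> eta01 h; have [eta0 eta1] := andP eta01.
have zq : z * q - q = 0.
  apply: (@eq0_geometricC _ (complex.Re `|z| * D + D * eta) eta) => // k.
  have -> : z * q - q = (z ^+ k.+1 - q) - z * (z ^+ k - q).
    by rewrite exprS; ring.
  rewrite (le_trans (ler_normB _ _))// normrM.
  have -> : toC ((complex.Re `|z| * D + D * eta) * eta ^+ k) =
     toC (D * eta ^+ k.+1) + `|z| * toC (D * eta ^+ k).
    have e : toC (complex.Re `|z|) = `|z| by rewrite normc_def.
    rewrite -[in RHS]e -rmorphM -rmorphD /=; congr toC; rewrite exprS; ring.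
  by rewrite lerD// ler_wpM2l.
have [q0|q0] := eqVneq q 0; last first.
  have z1 : z = 1 by apply: (mulIf q0); rewrite mul1r; apply/eqP; rewrite -subr_eq0 zq.
  left; split => //; apply/esym/eqP; rewrite -subr_eq0; apply/eqP.
  by apply: (eq0_geometricC (D := D) eta01) => k; have := h k; rewrite z1 expr1n.
right; split => //; rewrite real_ltNge ?normr_real ?real1//.
apply/negP => z1; have : (1 : C) = 0.
  apply: (eq0_geometricC (D := D) eta01) => k; apply: le_trans (h k).
  by rewrite q0 subr0 normr1 normrX exprn_ege1.
by move/eqP; rewrite oner_eq0.
Qed.

End ComplexPowers.

(** * The spectrum of a GSTP matrix *)

Section Spectrum.
Variables (R : realType) (n : nat).
Local Notation N := n.+1.
Local Notation C := R[i]%C.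
Local Notation toC := (real_complex R).

Definition dominant (rho : R) (S : {set 'I_N}) (D : 'I_N -> C) :=
  \prod_(i in S) D i = toC rho /\
  forall S' : {set 'I_N}, #|S'| = #|S| -> S' != S -> `|\prod_(i in S') D i| < toC rho.

Lemma norm_conj_entry m (P Q : 'M[C]_m) (M : 'M[R]_m) k (e : R) :
  `|M| <= e -> `|(P *m map_mx toC M *m Q) k k| <=
     (\sum_l (\sum_i `|P k i|) * `|Q l k|) * toC e.
Proof.
move=> Me; rewrite mxE (le_trans (ler_norm_sum _ _ _))// mulr_suml.
apply: ler_sum => l _; rewrite normrM mulrAC ler_wpM2r//.
rewrite mxE (le_trans (ler_norm_sum _ _ _))// mulr_suml.
apply: ler_sum => i _; rewrite normrM ler_wpM2l// mxE norm_toC lecR.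
exact: le_trans (entry_le_norm _ _ _) Me.
Qed.

(** The scaled diagonal entries [z k] of the compound of [U] have powers converging to the diagonal
    entries [q k] of the conjugated limit projection. *)
Lemma compound_dominant j (A : 'M[R]_N) (P U : 'M[C]_N) K rho v phi :
  perron_triple K (cpd j A) rho v phi -> P \in unitmx ->
  U = P *m map_mx toC A *m invmx P -> is_trig_mx U ->
  exists2 S : {set 'I_N}, #|S| = j & dominant rho S (fun i => U i i).
Proof.
move=> [rho0 _ phiv _ _ [eta [E [eta01 cvg]]]] Pu UE trU.
pose mu (k : 'I_#|jsets n j|) := \prod_(i in jsub k) U i i.
pose z k := mu k / toC rho.
pose Q := cpd j P; pose Q' := cpd j (invmx P).
have QQ' : Q' *m Q = 1%:M by rewrite -cpdM mulVmx// cpd1.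
pose q k := (Q *m map_mx toC (v *m phi) *m Q') k k.
have rhoC : toC rho != 0 by rewrite fmorph_eq0 gt_eqF.
have UX m : U ^+ m = P *m map_mx toC (A ^+ m) *m invmx P.
  elim: m => [|m ih]; first by rewrite !expr0 map_mx1 mulmx1 mulmxV.
  rewrite exprS ih {1}UE exprS -mulmxE map_mxM -!mulmxA; congr (_ *m (_ *m _)).
  by rewrite !mulmxA mulVmx// mul1mx.
have zX k m : z k ^+ m - q k =
    (Q *m map_mx toC ((rho ^+ m)^-1 *: cpd j A ^+ m - v *m phi) *m Q') k k.
  have [trX dgX] := trig_expr m trU.
  have ent a (X Y : 'M[C]_#|jsets n j|) : (a *: X - Y) k k = a * X k k - Y k k.
    by rewrite !mxE.
  have -> : z k ^+ m = (toC rho ^+ m)^-1 * cpd j (U ^+ m) k k.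
    rewrite cpd_trig_diag// (eq_bigr _ (fun i _ => dgX i)) prodrXl.
    by rewrite /z exprMn exprVn mulrC.
  rewrite UX !cpdM -map_cpd cpdX map_mxB map_mxZ fmorphV !rmorphXn /=.
  by rewrite mulmxBr mulmxBl -scalemxAr -scalemxAl ent.
have zP k : (z k = 1 /\ q k = 1) \/ (`|z k| < 1 /\ q k = 0).
  pose c := \sum_l (\sum_i `|Q k i|) * `|Q' l k|.
  have cE : toC (complex.Re c) = c.
    have : 0 <= c by apply: sumr_ge0 => l _; rewrite mulr_ge0// sumr_ge0.
    by move=> /ger0_norm <-; rewrite normc_def.
  apply: (@powers_cvgC _ _ _ (complex.Re c * E) eta) => // m.
  rewrite zX -mulrA rmorphM /= cE; exact: norm_conj_entry.
(* The trace of the conjugated projection is that of [v *m phi], which is [phi *m v]. *)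
have sumq : \sum_k q k = 1.
  have -> : \sum_k q k = \tr (Q *m map_mx toC (v *m phi) *m Q') by [].
  rewrite mxtrace_mulC mulmxA QQ' mul1mx trace_map_mx.
  by rewrite mxtrace_mulC /mxtrace big_ord1 phiv rmorph1.
have [k0 zk0] : exists k, z k = 1.
  apply: contrapT => h; move: sumq; rewrite big1 => [/eqP|k _].
    by rewrite eq_sym oner_eq0.
  by case: (zP k) => -[] // zk; case: h; exists k.
(* Each [q k] is 0 or 1 and they sum to 1, so no index other than [k0] can have [q k = 1]. *)
have lt1 k : k != k0 -> `|z k| < 1.
  move=> kk0; case: (zP k) => -[] // _ qk; exfalso.
  have qk0 : q k0 = 1.
    by case: (zP k0) => -[] //; rewrite zk0 normr1 ltxx.
  have qge l : 0 <= q l by case: (zP l) => -[_ ->].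
  move: sumq; rewrite (bigD1 k0)//= (bigD1 k)//= qk0 qk => /eqP.
  rewrite -subr_eq0 addrAC subrr add0r gt_eqF// ltr_wpDr//.
  by rewrite sumr_ge0.
have muE k : mu k = z k * toC rho by rewrite /z mulfVK.
exists (jsub k0); first exact: card_jsub.
split; first by have := muE k0; rewrite zk0 mul1r.
move=> S'; rewrite card_jsub => cS' nS'.
have S'j : S' \in jsets n j by rewrite inE cS'.
have [k S'E] : exists k : 'I_#|jsets n j|, S' = jsub k.
  by exists (enum_rank_in S'j S'); rewrite /jsub enum_rankK_in.
rewrite S'E -/(mu k) muE normrM norm_toC (gtr0_norm rho0).
have rC : 0 < toC rho by rewrite (ltcR 0).
rewrite gtr_pMl//; apply: lt1.
by apply: contra nS' => /eqP <-; rewrite S'E.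
Qed.

Variables (D : 'I_N -> C) (rho : nat -> R) (S : nat -> {set 'I_N}).
Hypothesis cardS : forall j, (j <= N)%N -> #|S j| = j.
Hypothesis domS : forall j, (j <= N)%N -> dominant (rho j) (S j) D.
Hypothesis rho_gt0 : forall j, (j <= N)%N -> 0 < rho j.

(** Replacing [i] by [i'] in the maximizing set lowers the modulus of the product; the common factor
    is nonzero because the full product is [rho j > 0]. *)
Lemma dominant_exchange j i i' : (j <= N)%N -> i \in S j -> i' \notin S j ->
  `|D i'| < `|D i|.
Proof.
move=> jN iS i'S; have [prodS ltS] := domS jN.
have ii' : i' != i by apply: contraNneq i'S => ->.
have i'S' : i' \notin S j :\ i by rewrite !inE negb_and i'S orbT.
have rj : 0 < toC (rho j) by rewrite (ltcR 0) rho_gt0.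
have := ltS (i' |: (S j :\ i))%SET.
rewrite cardsU1 i'S' (cardsD1 i (S j)) iS => /(_ erefl).
have -> : (i' |: (S j :\ i))%SET != S j.
  by apply: contraNneq i'S => <-; rewrite !inE eqxx.
move=> /(_ isT); rewrite big_setU1//= normrM.
have : `|D i| * `|\prod_(k in S j :\ i) D k| = toC (rho j).
  by rewrite -normrM -big_setD1//= prodS norm_toC gtr0_norm ?rho_gt0.
move=> e; rewrite -e in rj *; move=> h.
have : 0 < `|\prod_(k in S j :\ i) D k|.
  by rewrite lt0r normr_ge0 andbT; apply: contraTneq rj => ->; rewrite mulr0 ltxx.
by move=> p0; rewrite ltr_pM2r in h.
Qed.

(** An element lost from [S j] to [S j.+1] could be exchanged with one gained, giving opposite
    strict inequalities. *)
Lemma dominant_nested j : (j < N)%N -> S j \subset S j.+1.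
Proof.
move=> jN; apply/fintype.subsetP => i iS; apply/negPn/negP => iS1.
have [i' i'S1 i'S] : exists2 i', i' \in S j.+1 & i' \notin S j.
  apply/fintype.subsetPn; apply/negP => /subset_leq_card.
  by rewrite !cardS// ?ltnn// ltnW.
have := lt_trans (dominant_exchange (ltnW jN) iS i'S) (dominant_exchange jN i'S1 iS1).
by rewrite ltxx.
Qed.

(** With [rho 0 = 1] this is the eigenvalue of 0-based index [j]. *)
Definition growth_ratio j := rho j.+1 / rho j.

Lemma dominant_ratios :
  (forall i j : 'I_N, (i < j)%N -> growth_ratio j < growth_ratio i) /\
  \prod_(i < N) ('X - (D i)%:P) = \prod_(i < N) ('X - (toC (growth_ratio i))%:P).
Proof.
(* [S j.+1] gains exactly one element over [S j]; [ord0] is a filler outside the range. *)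
have new j : exists i, (j < N)%N -> S j.+1 = (i |: S j)%SET /\ i \notin S j.
  have [jN|jN] := ltnP j N; last by exists ord0.
  have : #|S j.+1 :\: S j| = 1%N.
    rewrite cardsD (finset.setIidPr (dominant_nested jN)) !cardS//; last exact: ltnW.
    by rewrite subSnn.
  move=> /eqP/cards1P[i iE]; exists i => _; split; last first.
    by have := finset.set11 i; rewrite -iE inE => /andP[].
  rewrite -iE finset.setUC finset.setDE finset.setUIr finset.setUCr finset.setIT.
  by rewrite (finset.setUidPr (dominant_nested jN)).
have [s sP] := choice new.
have Ds j : (j < N)%N -> D (s j) = toC (growth_ratio j).
  move=> jN; have [SE sS] := sP j jN.
  have [p1 _] := domS jN; have [p0 _] := domS (ltnW jN).
  move: p1; rewrite SE big_setU1//= p0 => e.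
  have r0 : toC (rho j) != 0 by rewrite fmorph_eq0 gt_eqF// rho_gt0// ltnW.
  by rewrite /growth_ratio rmorphM fmorphV /= -e mulfK.
have growth_ratio_gt0 j : (j < N)%N -> 0 < growth_ratio j.
  by move=> jN; rewrite divr_gt0// rho_gt0// ltnW.
have nested j k : (j <= k)%N -> (k <= N)%N -> S j \subset S k.
  elim: k => [|k ih]; first by rewrite leqn0 => /eqP->.
  rewrite leq_eqVlt => /predU1P[->//|jk] kN.
  by rewrite (fintype.subset_trans (ih jk (ltnW kN)))// dominant_nested.
have dec (i j : 'I_N) : (i < j)%N -> growth_ratio j < growth_ratio i.
  move=> ij; have [SE _] := sP i (ltn_ord i); have [_ sS] := sP j (ltn_ord j).
  have : `|D (s j)| < `|D (s i)|.
    apply: (@dominant_exchange j); [exact: ltnW| |exact: sS].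
    by apply: (fintype.subsetP (nested i.+1 j _ _)); rewrite // ?SE ?finset.setU11// ltnW.
  by rewrite !Ds// !norm_toC ltcR !gtr0_norm// growth_ratio_gt0.
split => //.
(* Strictly decreasing ratios make the gained elements distinct, so [s] permutes the indices and the
   product can be reindexed. *)
have sinj : injective (fun i : 'I_N => s i).
  move=> i j e; have : growth_ratio i = growth_ratio j.
    by apply: (@complexI R); rewrite -!Ds// e.
  move=> re; apply/val_inj => /=; apply/eqP; rewrite eqn_leq; apply/negPn/negP.
  by rewrite negb_and -!ltnNge => /orP[] /dec; rewrite re ltxx.
rewrite (reindex_inj sinj) /=; apply: eq_bigr => i _.
by rewrite Ds.
Qed.

End Spectrum.

(** * Simplicity of the Perron eigenvalue *)

Section PerronEigenvectors.
Variables (R : realType) (m : nat) (K : set 'cV[R]_m) (B : 'M[R]_m).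
Variables (rho : R) (v : 'cV[R]_m) (phi : 'rV[R]_m).
Hypothesis pt : perron_triple K B rho v phi.

(** The normalized powers fix [w], and they converge to [v *m phi]. *)
Lemma perron_right_unique (w : 'cV[R]_m) :
  B *m w = rho *: w -> w = (phi *m w) 0 0 *: v.
Proof.
have [rho0 _ _ _ _ [eta [E [eta01 cvg]]]] := pt => Bw.
have Bkw k : (rho ^+ k)^-1 *: (B ^+ k) *m w = w.
  rewrite -scalemxAl (_ : _ *m w = rho ^+ k *: w) ?scalerA ?mulVf ?scale1r//.
    by rewrite expf_neq0// gt_eqF.
  elim: k => [|k ih]; first by rewrite !expr0 mul1mx scale1r.
  by rewrite expr_mulmxS ih -scalemxAr Bw scalerA -exprSr.
apply/colP => i; apply/eqP; rewrite -subr_eq0 -normr_le0.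
apply: (le0_geometric (D := \sum_l E * `|w l 0|) eta01) => k.
have -> : w i 0 - ((phi *m w) 0 0 *: v) i 0 =
    (((rho ^+ k)^-1 *: (B ^+ k) - v *m phi) *m w) i 0.
  rewrite mulmxBl Bkw [in RHS]mxE -mulmxA [in X in _ = X]mxE; congr (_ + _).
  by rewrite mxE [in RHS]mxE big_ord1 mulrC.
rewrite mxE (le_trans (ler_norm_sum _ _ _))// mulr_suml.
apply: ler_sum => l _; rewrite normrM mulrAC ler_wpM2r//.
exact: le_trans (entry_le_norm _ _ _) (cvg k).
Qed.

Lemma perron_left_unique (psi : 'rV[R]_m) :
  psi *m B = rho *: psi -> psi = (psi *m v) 0 0 *: phi.
Proof.
have [rho0 _ _ _ _ [eta [E [eta01 cvg]]]] := pt => Bw.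
have Bkw k : psi *m ((rho ^+ k)^-1 *: (B ^+ k)) = psi.
  rewrite -scalemxAr (_ : psi *m _ = rho ^+ k *: psi) ?scalerA ?mulVf ?scale1r//.
    by rewrite expf_neq0// gt_eqF.
  elim: k => [|k ih]; first by rewrite !expr0 mulmx1 scale1r.
  by rewrite !exprSr mulmxA ih -scalemxAl Bw scalerA.
apply/rowP => i; apply/eqP; rewrite -subr_eq0 -normr_le0.
apply: (le0_geometric (D := \sum_l E * `|psi 0 l|) eta01) => k.
have -> : psi 0 i - ((psi *m v) 0 0 *: phi) 0 i =
    (psi *m ((rho ^+ k)^-1 *: (B ^+ k) - v *m phi)) 0 i.
  rewrite mulmxBr Bkw [in RHS]mxE mulmxA [in X in _ = X]mxE; congr (_ + _).
  by rewrite mxE [in RHS]mxE big_ord1.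
rewrite mxE (le_trans (ler_norm_sum _ _ _))// mulr_suml.
apply: ler_sum => l _; rewrite normrM [leLHS]mulrC [leRHS]mulrAC ler_wpM2r//.
exact: le_trans (entry_le_norm _ _ _) (cvg k).
Qed.

Lemma interior_negset (S : set 'cV[R]_m) x :
  interior (negset S) x <-> interior S (- x).
Proof.
split=> /interior_normP[e e0 eS]; apply/interior_normP; exists e => // y yx.
  by rewrite -[y]opprK; apply: eS; rewrite -opprD normrN -[x]opprK.
by apply: eS; rewrite -opprD normrN.
Qed.

Lemma interior_scale a : (forall (b : R) x, 0 <= b -> K x -> K (b *: x)) -> a != 0 ->
  interior K (a *: v) \/ interior (negset K) (a *: v).
Proof.
move=> KZ; have /interior_normP[e e0 eK] := perron_interior pt.
have pos b : 0 < b -> interior K (b *: v).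
  move=> b0; apply/interior_normP; exists (b * e); first by rewrite mulr_gt0.
  move=> y yv; have -> : y = b *: (b^-1 *: y) by rewrite scalerA mulfV ?scale1r// gt_eqF.
  apply: KZ; first exact: ltW.
  apply: eK; have -> : b^-1 *: y - v = b^-1 *: (y - b *: v).
    by rewrite scalerBr scalerA mulVf ?scale1r// gt_eqF.
  by rewrite normrZ gtr0_norm ?invr_gt0// ltr_pdivrMl.
rewrite neq_lt => /orP[a0|a0]; last by left; exact: pos.
by right; apply/interior_negset; rewrite -scaleNr; apply: pos; rewrite oppr_gt0.
Qed.

End PerronEigenvectors.

Lemma GSTP_spectrum (R : realType) (n : nat) (K : cone_family R n) (A : 'M[R]_n.+1) :
  TP_structure R n K -> GSTP R n K A ->
  exists rho : nat -> R,
    [/\ rho 0 = 1, (forall j, (j <= n.+1)%N -> 0 < rho j),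
       (forall j, (1 <= j <= n.+1)%N ->
          exists v phi, perron_triple (K j) (cpd j A) (rho j) v phi),
       (forall i j : 'I_n.+1, (i < j)%N -> growth_ratio rho j < growth_ratio rho i) &
       char_poly A = \prod_(i < n.+1) ('X - (growth_ratio rho i)%:P)].
Proof.
move=> TP GS.
(* The value 1 is the empty product for [j = 0] and a filler beyond the dimension. *)
have ex j : exists r, (j = 0%N -> r = 1) /\ ((1 <= j <= n.+1)%N ->
    exists v phi, perron_triple (K j) (cpd j A) r v phi).
  have [j1|] := boolP (1 <= j <= n.+1)%N; last first.
    by move=> _; exists 1.
  have [||r [v [phi pt]]] := @perron R _ (K j) (cpd j A) _ (TP j j1).
  - by rewrite /jsets card_draws card_ord bin_gt0; case/andP: j1.
  - exact: GS.
  by exists r; split=> [j0|_]; [move: j1; rewrite j0|exists v, phi].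
have [rho rhoP] := choice ex.
have rho0 : rho 0 = 1 by have [h _] := rhoP 0; exact: h.
have rho_gt0 j : (j <= n.+1)%N -> 0 < rho j.
  case: j => [|j] jN; first by rewrite rho0.
  by have [_ /(_ jN)[v [phi []]]] := rhoP j.+1.
pose toC := real_complex R.
have [P Pu trU] := @Schur _ n.+1 (map_mx toC A) isT.
have {}Pu : P \in unitmx by exact: unitarymx_unit.
pose U := P *m map_mx toC A *m invmx P.
have {}trU : is_trig_mx U by move: trU; rewrite /similar_to conjumx.
have domex j : exists S : {set 'I_n.+1}, (j <= n.+1)%N ->
    #|S| = j /\ dominant (rho j) S (fun i => U i i).
  case: j => [|j].
    exists (finset.set0); split; first by rewrite cards0.
    split; first by rewrite finset.big_set0 rho0 rmorph1.
    by move=> S'; rewrite cards0 => /eqP; rewrite finset.cards_eq0 => ->.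
  have [jN|] := boolP (j < n.+1)%N; last by exists finset.set0.
  have [_ /(_ jN)[v [phi pt]]] := rhoP j.+1.
  by have [S] := compound_dominant pt Pu erefl trU; exists S.
have [S SP] := choice domex.
have [dec prodE] := dominant_ratios (fun j jN => (SP j jN).1)
  (fun j jN => (SP j jN).2) rho_gt0.
exists rho; split => //; first by move=> j; exact: (rhoP j).2.
(* The factorization holds over the complex numbers and descends by injectivity of the embedding. *)
apply: (map_poly_inj toC); rewrite map_char_poly -(char_poly_conj _ Pu).
rewrite char_poly_trig// prodE rmorph_prod; apply: eq_bigr => i _.
by rewrite rmorphB /= map_polyX map_polyC.
Qed.

(** * The sets T(K_1, ..., K_j) *)

Lemma wedgeE (R : realType) n j (y : 'I_j -> 'cV[R]_n.+1) :
  wedge y = wdg (\matrix_(i, b) y b i 0).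
Proof.
apply/colP => k; rewrite !mxE; congr (\det _).
by apply/matrixP => a b; rewrite !mxE.
Qed.

Lemma wdg_mulr (R : comPzRingType) n j (Y : 'M[R]_(n.+1, j)) (D : 'M[R]_j) :
  wdg (Y *m D) = \det D *: wdg Y.
Proof. by apply/colP => k; rewrite !mxE -mul_rowsub_mx det_mulmx mulrC. Qed.

(** The rows of [X] are linear forms; this is their wedge in the dual basis, paired with wedges of
    vectors by [cowdg_wdg]. *)
Definition cowdg (R : comPzRingType) n j (X : 'M[R]_(j, n.+1)) :
    'rV[R]_#|jsets n j| :=
  \row_k \det (colsub (jidx k) X).

Lemma cowdg_wdg (R : comPzRingType) n j (X : 'M[R]_(j, n.+1)) (Y : 'M[R]_(n.+1, j)) :
  (cowdg X *m wdg Y) 0 0 = \det (X *m Y).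
Proof. by rewrite Cauchy_Binet mxE; apply: eq_bigr => k _; rewrite !mxE. Qed.

Lemma cowdg_cpd (R : comPzRingType) n j (X : 'M[R]_(j, n.+1)) (A : 'M[R]_n.+1) :
  cowdg X *m cpd j A = cowdg (X *m A).
Proof.
apply/rowP => l; rewrite !mxE.
have -> : colsub (jidx l) (X *m A) = X *m colsub (jidx l) A.
  by apply/matrixP => a b; rewrite !mxE; apply: eq_bigr => i _; rewrite !mxE.
rewrite Cauchy_Binet; apply: eq_bigr => k _; rewrite !mxE; congr (_ * \det _).
by apply/matrixP => a b; rewrite !mxE.
Qed.

Lemma cowdg_mull (R : comPzRingType) n j (X : 'M[R]_(j, n.+1)) (D : 'M[R]_j) :
  cowdg (D *m X) = \det D *: cowdg X.
Proof.
apply/rowP => l; rewrite !mxE -det_mulmx; congr (\det _).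
by apply/matrixP => a b; rewrite !mxE; apply: eq_bigr => i _; rewrite !mxE.
Qed.

Section Tsets.
Variables (R : realType) (n : nat) (K : cone_family R n).
Arguments K : clear implicits.
Local Notation T := (T R n K).

Lemma size_Tlist j : size (Tlist R n K j) = j.+1.
Proof. by elim: j => //= j ih; rewrite size_rcons ih. Qed.

Lemma nth_Tlist i j : (i <= j)%N -> nth set0 (Tlist R n K j) i = T i.
Proof.
elim: j => [|j ih]; first by rewrite leqn0 => /eqP->.
rewrite leq_eqVlt => /predU1P[->//|ij].
by rewrite /= nth_rcons size_Tlist ij ih.
Qed.

Lemma T_succ j : T j.+1 = Tstep R n K j.+1 (fun i => nth set0 (Tlist R n K j) i).
Proof. by rewrite /Defs.T /= nth_rcons size_Tlist ltnn eqxx. Qed.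

(** Covers both clauses of the recursion: the first level asks for the cone itself, later ones for
    its interior up to closure, hence the alternative [j = 0]. *)
Lemma T_sub_closure j : T j.+1 `<=` closure [set x | exists y : 'I_j.+1 -> 'cV[R]_n.+1,
  [/\ y ord0 = x, K j.+1 (wedge y) \/ negset (K j.+1) (wedge y) &
      j = 0%N \/ interior (K j.+1) (wedge y) \/ interior (negset (K j.+1)) (wedge y)]].
Proof.
rewrite T_succ; case: j => [|j] /=.
  move=> x Kx; apply: subset_closure; exists (fun=> x); split => //; by left.
apply: closure_subset => x [y [y0 _ Ky]]; exists y; split; [exact: y0| |by right].
by case: Ky => /interior_subset ?; [left|right].
Qed.

Lemma sub_T j x (y : 'I_j.+1 -> 'cV[R]_n.+1) : y ord0 = x ->
  (forall i : 'I_j.+1, (0 < i)%N -> T i (y i)) ->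
  interior (K j.+1) (wedge y) \/ interior (negset (K j.+1)) (wedge y) ->
  T j.+1 x.
Proof.
move=> y0 yT yK; rewrite T_succ; case: j y y0 yT yK => [|j] y y0 yT yK /=.
  have -> : iota1 x = wedge y.
    by congr wedge; apply/funext => i; rewrite ord1 y0.
  by case: yK => /interior_subset ?; [left|right].
apply: subset_closure; exists y; split => //.
  by move=> i i0; rewrite -y0; congr y; apply/val_inj.
move=> i i0; rewrite -/(Tlist R n K j.+1) nth_Tlist; first exact: yT.
by rewrite -ltnS.
Qed.

(* The wedge product is linear, hence continuous, in its first factor. *)
Lemma interior_T j x (y : 'I_j.+1 -> 'cV[R]_n.+1) : y ord0 = x ->
  (forall i : 'I_j.+1, (0 < i)%N -> T i (y i)) ->
  interior (K j.+1) (wedge y) \/ interior (negset (K j.+1)) (wedge y) ->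
  interior (T j.+1) x.
Proof.
move=> y0 yT yK.
pose y' z (i : 'I_j.+1) := if i == ord0 then z else y i.
pose M z (k : 'I_#|jsets n j.+1|) :=
  \matrix_(a < j.+1, b < j.+1) (y' z b) (sidx (jsub k) a) (0 : 'I_1).
(* Cofactors along the first column do not involve the first factor, so [c] is a Lipschitz
   constant. *)
pose c := \sum_(k < #|jsets n j.+1|) \sum_a `|cofactor (M x k) a ord0|.
have y'x : y' x = y by apply/funext => i; rewrite /y'; case: eqP => [->|].
have lip z : `|wedge (y' z) - wedge y| <= c * `|z - x|.
  apply: norm_le_entries => [|k l].
    by rewrite mulr_ge0// sumr_ge0// => k _; exact: sumr_ge0.
  rewrite -y'x !mxE ord1 -/(M z k) -/(M x k).
  rewrite (expand_det_col _ ord0) [X in _ - X](expand_det_col _ ord0) -sumrB.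
  have cof a : cofactor (M z k) a ord0 = cofactor (M x k) a ord0.
    congr (_ * \det _); apply/matrixP => p q; rewrite !mxE /y'.
    by rewrite eq_sym (negPf (neq_lift _ _)).
  rewrite (le_trans (ler_norm_sum _ _ _))// mulr_suml (bigD1 k)//= -[leLHS]addr0.
  apply: lerD; last by rewrite sumr_ge0// => i _; rewrite mulr_ge0// sumr_ge0.
  rewrite mulr_suml; apply: ler_sum => a _; rewrite cof -mulrBl normrM mulrC.
  rewrite ler_wpM2l// !mxE /y' eqxx.
  by have := entry_le_norm (z - x) (sidx (jsub k) a) 0; rewrite !mxE.
have c1 : 0 < c + 1.
  by rewrite ltr_wpDl// sumr_ge0// => k _; exact: sumr_ge0.
have near_in (S : set 'cV[R]_#|jsets n j.+1|) : interior S (wedge y) ->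
    exists2 d, 0 < d & forall z, `|z - x| < d -> interior S (wedge (y' z)).
  move=> /nbhs_interior yS; have : interior (interior S) (wedge y) by [].
  move=> /interior_normP[e e0 eS]; exists (e / (c + 1)); first by rewrite divr_gt0.
  move=> z; rewrite ltr_pdivlMr// => zx.
  apply: eS; rewrite (le_lt_trans (lip z))// (le_lt_trans _ zx)// mulrC.
  by rewrite ler_wpM2l// lerDl.
have inT z : interior (K j.+1) (wedge (y' z)) \/
    interior (negset (K j.+1)) (wedge (y' z)) -> T j.+1 z.
  apply: sub_T; first by rewrite /y' eqxx.
  move=> i i0; rewrite /y' ifF; first exact: yT.
  by apply/negbTE; rewrite -val_eqE /= -lt0n.
case: yK => /near_in[d d0 dS]; apply/interior_normP; exists d => // z zx.
  by apply: inT; left; exact: dS.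
by apply: inT; right; exact: dS.
Qed.

End Tsets.

(** Applying [A] repeatedly to a dependence [w] gives a relation with weights [w_i * lambda_i ^+ k]
    for each [k]; the Vandermonde matrix is invertible, so every [w_i * x_i] vanishes. *)
Lemma eigenvectors_unitmx (F : fieldType) n (A : 'M[F]_n) (lambda : 'I_n -> F)
    (x : 'I_n -> 'cV[F]_n) :
  injective lambda -> (forall i, x i != 0 /\ A *m x i = lambda i *: x i) ->
  (\matrix_(i, b) x b i 0) \in unitmx.
Proof.
move=> linj xP; set P := \matrix_(i, b) x b i 0.
rewrite unitmxE unitfE; apply/negP => /eqP; rewrite -det_tr => /eqP/det0P[w w0 wP].
have [i0 wi0] : exists i, w 0 i != 0.
  apply/existsP; rewrite -negb_forall; apply: contra w0 => /forallP h.
  by apply/eqP/rowP => i; rewrite mxE; exact/eqP/h.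
pose V := (Vandermonde n (\row_i lambda i))^T.
pose M := \matrix_(r, i) (P r i * w 0 i).
have xk k : \sum_i (w 0 i * lambda i ^+ k) *: x i = 0.
  elim: k => [|k ih].
    apply/colP => r; rewrite summxE [RHS]mxE.
    have := congr1 (fun M : 'rV_n => M 0 r) wP; rewrite !mxE => e.
    by rewrite -[RHS]e; apply: eq_bigr => i _; rewrite !mxE expr0 mulr1.
  have := congr1 (mulmx A) ih; rewrite mulmx0 mulmx_sumr => e.
  rewrite -[RHS]e; apply: eq_bigr => i _.
  by rewrite -scalemxAr (xP i).2 scalerA exprSr mulrA.
have MV : M *m V = 0.
  apply/matrixP => r k; rewrite !mxE.
  have := congr1 (fun M : 'cV_n => M r 0) (xk k); rewrite summxE mxE => e.
  by rewrite -[RHS]e; apply: eq_bigr => i _; rewrite !mxE; ring.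
have Vu : V \in unitmx.
  rewrite unitmxE det_tr det_Vandermonde unitfE.
  apply/prodf_neq0 => i _; apply/prodf_neq0 => k ik.
  by rewrite !mxE subr_eq0 (inj_eq linj); apply: contraTneq ik => ->; rewrite ltnn.
have M0 : M = 0 by rewrite -[M](mulmxK Vu) MV mul0mx.
have /negP := (xP i0).1; apply; apply/eqP/colP => r; rewrite mxE.
have := congr1 (fun M : 'M_n => M r i0) M0; rewrite !mxE => /eqP.
by rewrite mulf_eq0 (negPf wi0) orbF => /eqP.
Qed.

Lemma wedge1_eq0 (R : realType) n (y : 'I_1 -> 'cV[R]_n.+1) :
  wedge y = 0 -> y ord0 = 0.
Proof.
rewrite wedgeE => w0; apply/colP => i.
have := cowdg_wdg (delta_mx 0 i) (\matrix_(r, b) y b r 0).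
by rewrite w0 mulmx0 det_mx11 -rowE !mxE => <-.
Qed.

(** * Eigenbasis coordinates and membership in the sets T *)

Section Eigenbasis.
Variables (R : realType) (n : nat) (K : cone_family R n) (A : 'M[R]_n.+1).
Arguments K : clear implicits.
Local Notation N := n.+1.
Local Notation T := (T R n K).
Hypothesis Kproper : TP_structure R n K.
Variable rho : nat -> R.
Hypothesis rho0 : rho 0 = 1.
Hypothesis rho_gt0 : forall j, (j <= N)%N -> 0 < rho j.
Hypothesis rhoP : forall j, (1 <= j <= N)%N ->
  exists v phi, perron_triple (K j) (cpd j A) (rho j) v phi.
Hypothesis decreasing :
  forall i j : 'I_N, (i < j)%N -> growth_ratio rho j < growth_ratio rho i.
Variable x : 'I_N -> 'cV[R]_N.
Hypothesis xP : forall i, x i != 0 /\ A *m x i = growth_ratio rho i *: x i.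

(** The columns of [P] are the eigenvectors; the rows of its inverse [L] are the coordinate forms,
    which are left eigenvectors. *)
Let P := \matrix_(i, b) x b i 0.
Let L := invmx P.

Let Pu : P \in unitmx.
Proof.
apply: eigenvectors_unitmx xP => i j e; apply/val_inj/eqP => /=.
rewrite eqn_leq; apply/negPn/negP.
by rewrite negb_and -!ltnNge => /orP[] /decreasing; rewrite e ltxx.
Qed.

Let AP : A *m P = P *m diag_mx (\row_i growth_ratio rho i).
Proof.
apply/matrixP => r i; rewrite mul_mx_diag !mxE.
have := congr1 (fun M : 'cV_N => M r 0) (xP i).2; rewrite !mxE mulrC => <-.
by apply: eq_bigr => k _; rewrite !mxE.
Qed.

Let LA : L *m A = diag_mx (\row_i growth_ratio rho i) *m L.
Proof.
by rewrite -[LHS](mulmxK Pu) -(mulmxA L) AP -/L mulmxA mulVmx// mul1mx.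
Qed.

Lemma coord_eigenvector i : L *m x i = delta_mx i 0.
Proof.
have -> : x i = P *m delta_mx i 0.
  by rewrite -colE; apply/colP => r; rewrite !mxE.
by rewrite mulmxA mulVmx// mul1mx.
Qed.

Lemma prod_growth_ratio j (jN : (j <= N)%N) :
  \prod_(b < j) growth_ratio rho b = rho j.
Proof.
elim: j jN => [|j ih] jN; first by rewrite big_ord0.
rewrite big_ord_recr /= ih; last exact: ltnW.
by rewrite mulrC mulfVK// gt_eqF// rho_gt0// ltnW.
Qed.

(** Both wedges are eigenvectors of the compound for [rho j], the product of the first [j] ratios,
    so simplicity applies. Their pairing is 1, so neither scalar vanishes. *)
Lemma leading_wedge j (jN : (j <= N)%N) v phi : (1 <= j)%N ->
  perron_triple (K j) (cpd j A) (rho j) v phi ->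
  (exists2 a, a != 0 & wdg (colsub (widen_ord jN) P) = a *: v) /\
  (exists2 b, b != 0 & cowdg (rowsub (widen_ord jN) L) = b *: phi).
Proof.
move=> j1 pt.
set W := wdg _; set psi := cowdg _.
pose D := diag_mx (\row_(b < j) growth_ratio rho (widen_ord jN b)).
have detD : \det D = rho j.
  rewrite det_diag -prod_growth_ratio//; apply: eq_bigr => b _; by rewrite mxE.
have WE : cpd j A *m W = rho j *: W.
  rewrite cpd_wdg -detD -wdg_mulr; congr wdg.
  have -> : A *m colsub (widen_ord jN) P = colsub (widen_ord jN) (A *m P).
    by apply/matrixP => a b; rewrite !mxE; apply: eq_bigr => i _; rewrite !mxE.
  by rewrite AP; apply/matrixP => a b; rewrite mxE !mul_mx_diag !mxE.
have psiE : psi *m cpd j A = rho j *: psi.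
  rewrite cowdg_cpd -detD -cowdg_mull; congr cowdg.
  rewrite mul_rowsub_mx LA.
  by apply/matrixP => a b; rewrite mxE !mul_diag_mx !mxE.
have psiW : (psi *m W) 0 0 = 1.
  rewrite cowdg_wdg (_ : _ *m _ = 1%:M) ?det1//.
  have -> : rowsub (widen_ord jN) L *m colsub (widen_ord jN) P =
      mxsub (widen_ord jN) (widen_ord jN) (L *m P).
    by apply/matrixP => a b; rewrite !mxE; apply: eq_bigr => i _; rewrite !mxE.
  by rewrite mulVmx//; apply/matrixP => a b; rewrite !mxE.
have eW := perron_right_unique pt WE; have ep := perron_left_unique pt psiE.
split.
  exists ((phi *m W) 0 0) => //; apply/eqP => e; move: psiW.
  by rewrite eW e scale0r mulmx0 mxE => /eqP; rewrite eq_sym oner_eq0.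
exists ((psi *m v) 0 0) => //; apply/eqP => e; move: psiW.
by rewrite ep e scale0r mul0mx mxE => /eqP; rewrite eq_sym oner_eq0.
Qed.

(** Induction on [p]: with indicator coefficients the hypothesis puts the earlier eigenvectors into
    their own [T], so they can serve as the other factors. *)
Lemma leading_sum_interior p (c : 'I_N -> R) : (1 <= p <= N)%N ->
  (forall i : 'I_N, i.+1 = p -> c i != 0) ->
  interior (T p) (\sum_(i < N | (i < p)%N) c i *: x i).
Proof.
elim/ltn_ind: p c => -[//|p] ih c pN cp.
have hp : (p.+1 <= N)%N by [].
have [v [phi pt]] := rhoP pN.
have [[a a0 Wa] _] := leading_wedge hp isT pt.
set s := \sum_(i < N | _) _.
(* Factor [b] has to lie in [T b], and the eigenvector of 0-based index [b - 1] does. *)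
pose y (b : 'I_p.+1) := if b == ord0 then s else x (inord b.-1).
apply: (@interior_T _ _ _ _ _ y); first by rewrite /y eqxx.
  move=> b b0; have bE : (b == ord0) = false by apply/negbTE; rewrite -val_eqE /= -lt0n.
  have bp : (b.-1 < N)%N by rewrite prednK// (leq_trans (ltnW (ltn_ord b))).
  rewrite /y bE; apply: interior_subset.
  have := ih b (ltn_ord b) (fun i => (i == inord b.-1)%:R).
  rewrite (bigD1 (inord b.-1)) /=; last by rewrite inordK// prednK.
  rewrite eqxx scale1r big1 ?addr0; last first.
    by move=> i /andP[_ /negPf ->]; rewrite scale0r.
  apply; first by rewrite b0 (leq_trans (ltnW (ltn_ord b))).
  move=> i ib; rewrite -val_eqE /= inordK// -ib /= eqxx; exact: oner_neq0.
pose C := \matrix_(i < p.+1, b < p.+1)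
  if b == ord0 then c (widen_ord hp i) else (i.+1 == b)%:R.
have -> : wedge y = \det C *: wdg (colsub (widen_ord hp) P).
  rewrite wedgeE -wdg_mulr; congr wdg; apply/matrixP => r b; rewrite !mxE /y.
  case: ifP => b0.
    rewrite summxE (big_ord_narrow hp).
    by apply: eq_bigr => i _; rewrite !mxE b0 mulrC.
  have b1 : (0 < b)%N by rewrite lt0n; apply/negbT.
  have bp : (b.-1 < p.+1)%N by rewrite prednK// ltnW.
  rewrite (bigD1 (Ordinal bp))//= big1 ?addr0; last first.
    move=> i ib; rewrite !mxE b0; case: eqP => [e|_]; last by rewrite mulr0.
    by move: ib; rewrite -val_eqE /= -e /= eqxx.
  rewrite !mxE b0 /= prednK// eqxx mulr1; congr (x _ r 0).
  by apply/val_inj; rewrite /= inordK// (leq_trans bp).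
(* The last row of [C] has its only nonzero entry in column 0, namely the last coefficient; the
   complementary minor is the identity. *)
have detC : \det C != 0.
  rewrite (expand_det_row _ ord_max) (bigD1 ord0)//= big1 ?addr0; last first.
    move=> b b0; rewrite mxE (negPf b0) /= gtn_eqF ?mul0r// ltn_ord.
  rewrite mxE /= mulf_neq0//; first by apply: cp.
  rewrite /cofactor mulf_neq0 ?signr_eq0// (_ : row' _ _ = 1%:M) ?det1 ?oner_neq0//.
  apply/matrixP => i b; rewrite !mxE /=.
  by rewrite -val_eqE /= /bump leqNgt ltn_ord.
rewrite Wa scalerA; apply: (interior_scale pt); last exact: mulf_neq0.
by case: (Kproper pN).
Qed.

(** The leading minor [det M] is [phi] at the wedge up to the factor [b], so at least
    [|b| * c * |w|]. Minors with one leading row replaced are at most [G * |w|], and [|w|] cancels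
    in the quotient. *)
Lemma T_coord_bound j (jN : (j.+1 <= N)%N) : exists C, forall y : 'I_j.+1 -> 'cV[R]_N,
  K j.+1 (wedge y) \/ negset (K j.+1) (wedge y) -> wedge y != 0 ->
  forall i, `|(L *m y ord0) i 0| <=
    C * \sum_(a < j.+1) `|(L *m y ord0) (widen_ord jN a) 0|.
Proof.
have [v [phi pt]] := rhoP (j := j.+1) jN.
have [_ [b b0 psiE]] := leading_wedge jN isT pt.
have [c c0 coer] := perron_coercive pt.
(* The leading indices with the one at position [a] replaced by [i]. *)
pose f i (a d : 'I_j.+1) := if d == a then i else widen_ord jN d.
pose G := \sum_i \sum_a \sum_k `|cowdg (rowsub (f i a) L) 0 k|.
have G0 : 0 <= G by do 3 (apply: sumr_ge0 => ? _).
exists (G / (`|b| * c)) => y yK y0 i.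
set w := wedge y in yK y0.
pose Y := \matrix_(r, d) y d r 0 : 'M[R]_(N, j.+1).
have wE : w = wdg Y by exact: wedgeE.
pose Z := L *m Y; pose M := rowsub (widen_ord jN) L *m Y.
have nw : 0 < `|w| by rewrite normr_gt0.
have ZE r : Z r ord0 = (L *m y ord0) r 0.
  by rewrite !mxE; apply: eq_bigr => l _; rewrite !mxE.
have ME a : M a ord0 = (L *m y ord0) (widen_ord jN a) 0.
  by rewrite /M mul_rowsub_mx mxE ZE.
have phiw : c * `|w| <= `|(phi *m w) 0 0|.
  case: yK => /coer h; first by rewrite (le_trans h)// ler_norm.
  by rewrite normrN mulmxN mxE in h; rewrite (le_trans h)// -normrN ler_norm.
have detM : `|b| * c * `|w| <= `|\det M|.
  rewrite -cowdg_wdg -wE psiE -scalemxAl mxE normrM -mulrA.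
  by rewrite ler_wpM2l.
(* Expansion along row [a], whose cofactors are those of [M]. *)
have adjE a : (Z *m \adj M) i a = \det (rowsub (f i a) L *m Y).
  rewrite (expand_det_row _ a) mxE; apply: eq_bigr => d _; rewrite !mxE.
  congr (_ * _).
    by apply: eq_bigr => l _; rewrite !mxE /f eqxx.
  congr (_ * \det _); apply/matrixP => p q; rewrite !mxE.
  apply: eq_bigr => l _; rewrite !mxE /f ifN//; by rewrite eq_sym neq_lift.
have adjb a : `|(Z *m \adj M) i a| <= G * `|w|.
  rewrite adjE -cowdg_wdg -wE mxE (le_trans (ler_norm_sum _ _ _))//.
  apply: (@le_trans _ _ ((\sum_k `|cowdg (rowsub (f i a) L) 0 k|) * `|w|)).
    rewrite mulr_suml; apply: ler_sum => k _; rewrite normrM.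
    by rewrite ler_wpM2l// entry_le_norm.
  rewrite ler_wpM2r// /G (bigD1 i)//= (bigD1 a)//= -addrA lerDl addr_ge0//.
    by apply: sumr_ge0 => ? _; exact: sumr_ge0.
  by apply: sumr_ge0 => ? _; apply: sumr_ge0 => ? _; exact: sumr_ge0.
(* Cramer's rule: Z adj(M) M = det(M) Z, where M is the leading block of Z. *)
have cramer : \det M * Z i ord0 = \sum_a (Z *m \adj M) i a * M a ord0.
  have := congr1 (fun X : 'M[R]_(N, j.+1) => X i ord0) (mulmxA Z (\adj M) M).
  by rewrite mul_adj_mx mul_mx_scalar mxE => ->; rewrite mxE.
have bc : 0 < `|b| * c by rewrite mulr_gt0// normr_gt0.
rewrite -ZE mulrAC ler_pdivlMr// -(ler_pM2r nw) mulrC [_ * (`|b| * c)]mulrC mulrA.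
rewrite [`|w| * _]mulrC.
apply: (@le_trans _ _ (`|\det M| * `|Z i ord0|)); first by rewrite ler_wpM2r.
rewrite -normrM cramer (le_trans (ler_norm_sum _ _ _))// mulrAC mulr_sumr.
by apply: ler_sum => a _; rewrite normrM ME ler_wpM2r.
Qed.

(** Points [u] near [z] satisfy the bound of [T_coord_bound] and have small leading coordinates,
    hence only small coordinates. *)
Lemma T_leading_coords_eq0 j z : (j <= N)%N -> T j z ->
  (forall a : 'I_N, (a < j)%N -> (L *m z) a 0 = 0) -> z = 0.
Proof.
case: j => [//|j] jN Tz z0.
have [C CP] := T_coord_bound jN.
suff Lz : L *m z = 0 by rewrite -[z]mul1mx -(mulmxV Pu) -mulmxA -/L Lz mulmx0.
apply/colP => i; rewrite [RHS]mxE; apply/eqP; rewrite -normr_le0.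
have l0 := mx_l1_ge0 L; set l := mx_l1 L in l0.
(* One [l] for passing from [u] to [z] in coordinate [i], and [|C| * j.+1] more for the leading
   coordinates of [u]. *)
pose E := l * (1 + `|C| * j.+1%:R).
have E0 : 0 <= E by rewrite mulr_ge0// addr_ge0// mulr_ge0.
have coordB (u : 'cV[R]_N) r : `|(L *m u) r 0 - (L *m z) r 0| <= l * `|u - z|.
  have := entry_le_norm (L *m (u - z)) r 0; rewrite mulmxBr !mxE => h.
  apply: (le_trans h); rewrite -mulmxBr; exact: norm_mulmx_le.
apply/ler_addgt0Pr => e e0; rewrite add0r.
have E1 : 0 < E + 1 by rewrite ltr_wpDl.
have /closure_normP/(_ (e / (E + 1))) := T_sub_closure Tz.
case; first by rewrite divr_gt0.
move=> u [y [yu yK yI]] uz.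
have nE : E * `|u - z| <= e.
  move: uz; rewrite ltr_pdivlMr// mulrC => /ltW; apply: le_trans.
  by rewrite ler_wpM2r// lerDl.
have bnd : `|(L *m u) i 0| <= C * \sum_(a < j.+1) `|(L *m u) (widen_ord jN a) 0|.
  (* A zero wedge is possible only at the first level, where it forces [u = 0]; later wedges are
     interior up to sign, hence nonzero. *)
  have [w0|w0] := eqVneq (wedge y) 0; last by rewrite -yu; exact: CP.
  case: yI => [j0|yI].
    have -> : u = 0 by rewrite -yu; move: y w0 {yu yK}; rewrite j0; exact: wedge1_eq0.
    by rewrite mulmx0 mxE normr0 big1 ?mulr0// => a _; rewrite mxE normr0.
  have card_gt0 : (0 < #|jsets n j.+1|)%N.
    by rewrite /jsets card_draws card_ord bin_gt0.
  have neq0 := interior_cone_neq0 (Kproper (j := j.+1) jN) card_gt0.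
  case: yI => [/neq0|/interior_negset/neq0]; first by rewrite w0 eqxx.
  by rewrite w0 oppr0 eqxx.
have h := coordB u i.
have s1 : \sum_(a < j.+1) `|(L *m u) (widen_ord jN a) 0| <= j.+1%:R * (l * `|u - z|).
  rewrite -[X in X%:R * _]card_ord -sum1_card natr_sum mulr_suml.
  apply: ler_sum => a _; rewrite mul1r.
  by have := coordB u (widen_ord jN a); rewrite z0 ?subr0//=.
have s0 : 0 <= \sum_(a < j.+1) `|(L *m u) (widen_ord jN a) 0| by exact: sumr_ge0.
have s2 : C * \sum_(a < j.+1) `|(L *m u) (widen_ord jN a) 0| <=
    `|C| * (j.+1%:R * (l * `|u - z|)).
  by apply: (le_trans (ler_wpM2r s0 (ler_norm C))); rewrite ler_wpM2l.
apply: le_trans nE.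
have : `|(L *m z) i 0| <= `|(L *m u) i 0| + `|(L *m u) i 0 - (L *m z) i 0|.
  by rewrite -{1}(subKr ((L *m u) i 0) ((L *m z) i 0)) ler_normB.
move=> h3; apply: (le_trans h3).
rewrite /E mulrAC mulrDr mulr1 addrC; apply: lerD => //.
apply: (le_trans bnd); apply: (le_trans s2).
by rewrite le_eqVlt; apply/orP; left; apply/eqP; ring.
Qed.

Lemma eigen_sum q p (c : 'I_N -> R) : (1 <= q)%N -> (q <= p)%N -> (p <= N)%N ->
  let s := \sum_(i < N | (q <= i.+1 <= p)%N) c i *: x i in
  (forall i : 'I_N, i.+1 = p -> c i != 0 -> interior (T p) s /\ ~ T q.-1 s)
  /\ closure (T p `\` T q.-1) s.
Proof.
move=> q1 qp pN s.
have p1 : (1 <= p)%N := leq_trans q1 qp.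
(* Stated for arbitrary coefficients, to be reused for a perturbation of [c]. *)
have main (d : 'I_N -> R) (t := \sum_(i < N | (q <= i.+1 <= p)%N) d i *: x i) :
    (forall i : 'I_N, i.+1 = p -> d i != 0) -> interior (T p) t /\ ~ T q.-1 t.
  move=> dp; split.
    pose d' (i : 'I_N) := if (q <= i.+1)%N then d i else 0.
    have -> : t = \sum_(i < N | (i < p)%N) d' i *: x i.
      rewrite /t big_mkcond [RHS]big_mkcond; apply: eq_bigr => i _; rewrite /d'.
      by case: (q <= i.+1)%N => //=; rewrite scale0r; case: ifP.
    apply: leading_sum_interior; first by rewrite p1.
    by move=> i ip; rewrite /d' ip qp; exact: dp.
  have Lt a : (L *m t) a 0 = if (q <= a.+1 <= p)%N then d a else 0.
    rewrite /t mulmx_sumr summxE big_mkcond (bigD1 a)//= big1 ?addr0.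
      by rewrite -scalemxAr coord_eigenvector !mxE !eqxx mulr1.
    move=> i ia; case: ifP => // _.
    by rewrite -scalemxAr coord_eigenvector !mxE eq_sym (negPf ia) mulr0.
  (* The first [q - 1] coordinates of [t] vanish, so [t = 0], against its nonzero last
     coefficient. *)
  move=> Tt; have t0 : t = 0.
    apply: T_leading_coords_eq0 Tt _; first by rewrite (leq_trans (leq_pred _))// (leq_trans qp).
    move=> a aq; rewrite Lt ifN// negb_and -ltnNge.
    by rewrite -(prednK q1) ltnS aq.
  have pp : (p.-1 < N)%N by rewrite prednK.
  have := Lt (Ordinal pp); rewrite t0 mulmx0 mxE /= prednK// qp leqnn /= => /esym/eqP.
  by apply/negP; apply: dp; rewrite /= prednK.
split.
  move=> i ip ci; apply: main => k kp.
  by have -> : k = i by apply/val_inj/eq_add_S; rewrite /= ip.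
apply/closure_normP => e e0.
have pp : (p.-1 < N)%N by rewrite prednK.
pose i0 := Ordinal pp.
have i0p (i : 'I_N) : i.+1 = p -> i = i0 by move=> ip; apply/val_inj => /=; rewrite -ip.
have x0 : 0 < `|x i0| by rewrite normr_gt0 (xP i0).1.
(* If the last coefficient is zero, a multiple of the last eigenvector of norm [e / 2] makes it
   nonzero. *)
pose r := if c i0 == 0 then e / 2 / `|x i0| else 0.
pose d i := c i + r * (i == i0)%:R.
exists (\sum_(i < N | (q <= i.+1 <= p)%N) d i *: x i).
  have [|h1 h2] := main d; last by split => //; exact: interior_subset.
  move=> i /i0p ->; rewrite /d eqxx mulr1 /r.
  have [->|ci0] := eqVneq (c i0) 0; last by rewrite addr0.
  by rewrite add0r gt_eqF// !divr_gt0.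
have -> : \sum_(i < N | (q <= i.+1 <= p)%N) d i *: x i = s + r *: x i0.
  rewrite (eq_bigr (fun i => c i *: x i + (r * (i == i0)%:R) *: x i)); last first.
    by move=> i _; rewrite -scalerDl.
  rewrite big_split /=; congr (_ + _).
  rewrite (bigD1 i0) /=; last by rewrite prednK// qp leqnn.
  rewrite eqxx mulr1 big1 ?addr0// => i /andP[_ /negPf ->].
  by rewrite mulr0 scale0r.
rewrite addrAC subrr add0r normrZ /r; case: ifP => _; last by rewrite normr0 mul0r.
rewrite gtr0_norm ?divr_gt0// mulfVK ?gt_eqF//.
by rewrite ltr_pdivrMr// ltr_pMr// ltrDl.
Qed.

Lemma first_eigenvector_interior : interior (K 1%N) (iota1 (x ord0)) \/
  interior (negset (K 1%N)) (iota1 (x ord0)).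
Proof.
have h1 : (1 <= N)%N by [].
have [v [phi pt]] := rhoP (j := 1) h1.
have [[a a0 Wa] _] := leading_wedge h1 isT pt.
have -> : iota1 (x ord0) = a *: v.
  rewrite -Wa /iota1 wedgeE; congr wdg; apply/matrixP => i b; rewrite !mxE.
  by congr (x _ i 0); apply/val_inj; rewrite /= (ord1 b).
by apply: (interior_scale pt) a0; case: (Kproper (j := 1) h1).
Qed.

End Eigenbasis.

Unset Implicit Arguments.

(* Dimension is n.+1; eigen-indices are 0-based: lambda i = lambda_(i+1). *)
Theorem theorem22 (R : realType) (n : nat)
    (K : cone_family R n) (A : 'M[R]_n.+1) :
  TP_structure R n K -> GSTP R n K A ->
  exists lambda : 'I_n.+1 -> R,
    [/\ char_poly A = \prod_(i < n.+1) ('X - (lambda i)%:P),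
        (forall i j : 'I_n.+1, (i < j)%N -> lambda j < lambda i),
        (forall i : 'I_n.+1, 0 < lambda i)
      & forall x : 'I_n.+1 -> 'cV[R]_n.+1,
          (forall i, x i != 0 /\ A *m x i = lambda i *: x i) ->
          [/\ interior (K 1%N) (iota1 (x ord0))
                \/ interior (negset (K 1%N)) (iota1 (x ord0)),
              (forall j : 'I_n.+1, (1 <= j)%N ->
                 interior (T R n K j.+1) (x j) /\ ~ T R n K j (x j))
            & forall (q p : nat) (c : 'I_n.+1 -> R),
                (1 <= q)%N -> (q <= p)%N -> (p <= n.+1)%N ->
                let s := \sum_(i < n.+1 | (q <= i.+1 <= p)%N) c i *: x i in
                (forall i : 'I_n.+1, i.+1 = p -> c i != 0 ->
                   interior (T R n K p) s /\ ~ T R n K q.-1 s)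
                /\ closure (T R n K p `\` T R n K q.-1) s]].
Proof.
move=> TP GS; have [rho [rho0 rho_gt0 rhoP dec charE]] := GSTP_spectrum TP GS.
exists (fun i => growth_ratio rho i); split => //.
  by move=> i; rewrite divr_gt0// rho_gt0// ltnW.
move=> x xP.
have sums := eigen_sum TP rho0 rho_gt0 rhoP dec xP.
split; [exact: (first_eigenvector_interior TP rho0 rho_gt0 rhoP dec xP)| |exact: sums].
(* A single eigenvector is the sum with [q = p = j.+1] and coefficient 1. *)
move=> j _; have [/(_ j erefl)] := sums j.+1 j.+1 (fun=> 1) isT (leqnn _) (ltn_ord j).
rewrite oner_neq0 => /(_ isT) h _; move: h.
rewrite (eq_bigl (pred1 j)) ?big_pred1_eq ?scale1r// => i.
by rewrite -eqn_leq eqSS eq_sym.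
Qed.
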